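(* Let $M^n$ be a Riemannian manifold with locally convex boundary. In the Riemannian cylinder $M\times\mathbb{R}$ consider a product weight $e^{\psi(p,t)}:=e^{h(p)}\,e^{v(t)}$, where $h\in C^\infty(M)$ and $v\in C^\infty(\mathbb{R})$. Suppose that $\mathrm{Ric}_v\leq c\leq\mathrm{Ric}_h$ for some constant $c\in\mathbb{R}$. Consider a $\psi$-parabolic entire horizontal graph $\Sigma$ in $M\times\mathbb{R}$ with constant $\psi$-mean curvature and free boundary in $\partial M\times\mathbb{R}$. If one of the following hypotheses holds: (i) $\mathrm{Ric}_h(w,w)>c\,|w|^2$ for any non-zero tangent vector $w$ of $M$, (ii) $\partial M$ is locally strictly convex, (iii) $h$ is constant and $c\neq 0$, then $\Sigma=M_s$ for some $s\in\mathbb{R}$.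
   Context: A Riemannian cylinder $M^n\times\mathbb{R}$ is the Riemannian product of a complete, connected, oriented $n$-dimensional Riemannian manifold $M$ (possibly with smooth boundary $\partial M$) with the standard line $\mathbb{R}$; $M_s:=M\times\{s\}$ is the horizontal slice at height $s$. An entire horizontal graph is a set $\{(p,\varphi(p)):p\in M\}$ with $\varphi\in C^\infty(M)$, with the downward unit normal $N=(\nabla_M\varphi,-1)/\sqrt{1+|\nabla_M\varphi|^2}$. For a weight $e^\psi$ on a Riemannian manifold, the Bakry-Émery-Ricci tensor is $\mathrm{Ric}_\psi:=\mathrm{Ric}-\nabla^2\psi$. $\mathrm{Ric}_h$ is the corresponding tensor of $M$ with weight $e^h$, and $\mathrm{Ric}_v$ that of $\mathbb{R}$ with weight $e^v$. Thus $c\leq\mathrm{Ric}_h$ means $\mathrm{Ric}_p(w,w)-(\nabla^2h)_p(w,w)\geq c\,|w|^2$ for all $p\in M$, $w\in T_pM$, and $\mathrm{Ric}_v\leq c$ means $-v''(t)\leq c$ for all $t\in\mathbb{R}$. For a hypersurface $\Sigma$ (possibly with smooth boundary $\partial\Sigma$) with unit normal $N$, the $\psi$-mean curvature is $H_\psi:=-\operatorname{div}_\Sigma N-\langle\nabla\psi,N\rangle$. On $\Sigma$ with the induced metric, $\Delta_{\Sigma,\psi}u:=\Delta_\Sigma u+\langle\nabla_\Sigma\psi,\nabla_\Sigma u\rangle$. $\Sigma$ is $\psi$-parabolic if every $u\in C^2(\Sigma)$ that is bounded from above, satisfies $\Delta_{\Sigma,\psi}u\geq 0$ on $\Sigma\setminus\partial\Sigma$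 and $\partial u/\partial\nu\geq 0$ along $\partial\Sigma$ ($\nu$ the inner unit conormal) is constant. A hypersurface with $\partial\Sigma\neq\emptyset$ has free boundary in $\partial M\times\mathbb{R}$ if $\partial\Sigma=\Sigma\cap(\partial M\times\mathbb{R})$ and $\Sigma$ is orthogonal to $\partial M\times\mathbb{R}$ along $\partial\Sigma$. $\partial M$ is locally convex (resp. locally strictly convex) if its second fundamental form with respect to the inner unit normal is positive semidefinite (resp. positive definite), with the sign convention $\langle D_XY,\eta\rangle$, where $\eta$ is the inner unit normal and $D$ the Levi-Civita connection. *)

(* Defs.v *)
From mathcomp Require Import all_boot all_order all_algebra.
From mathcomp Require Import all_classical all_reals all_analysis.
Import Order.TTheory GRing.Theory Num.Theory numFieldNormedType.Exports.

Set Implicit Arguments.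
Unset Strict Implicit.
Unset Printing Implicit Defensive.

Local Open Scope classical_set_scope.
Local Open Scope ring_scope.

(** * Calculus up to the boundary *)

Definition quotient_in (R : realType) (D : set R) (f : R -> R) (t : R) :=
  ((f s - f t) / (s - t)) @[s --> within D t^'].

Definition derivable_in (R : realType) (D : set R) (f : R -> R) (t : R) :=
  cvg (quotient_in D f t).

(** The derivative relative to [D]: two-sided at interior points of [D],
    one-sided at the endpoints of an interval [D]. *)
Definition der_in (R : realType) (D : set R) (f : R -> R) (t : R) : R :=
  lim (quotient_in D f t).

Definition halfspace (R : realType) (d : nat) : set 'rV[R]_d.+1 :=
  [set x : 'rV[R]_d.+1 | 0 <= x 0 ord0].
Arguments halfspace R d _ : clear implicits.

Definition axis_line (R : realType) (d : nat) (i : 'I_d.+1) (x : 'rV[R]_d.+1)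
    (s : R) : 'rV[R]_d.+1 := x + s *: delta_mx 0 i.

(** Partial derivative relative to the half-space: it is one-sided only for
    [i = ord0] at a point of the boundary hyperplane. *)
Definition pd (R : realType) (d : nat) (i : 'I_d.+1) (f : 'rV[R]_d.+1 -> R)
    (x : 'rV[R]_d.+1) : R :=
  der_in (axis_line i x @^-1` halfspace R d) (f \o axis_line i x) 0.

Definition has_pd (R : realType) (d : nat) (i : 'I_d.+1)
    (f : 'rV[R]_d.+1 -> R) (x : 'rV[R]_d.+1) : Prop :=
  derivable_in (axis_line i x @^-1` halfspace R d) (f \o axis_line i x) 0.

(** [f] is of class C^m on [U], a relatively open subset of the half-space,
    up to the boundary. *)
Fixpoint Ck (R : realType) (d : nat) (m : nat) (U : set 'rV[R]_d.+1)
    (f : 'rV[R]_d.+1 -> R) : Prop :=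
  {within U, continuous f} /\
  if m is m'.+1 then
    forall i, (forall x, U x -> has_pd i f x) /\ Ck m' U (pd i f)
  else True.

Definition Cinfty (R : realType) (d : nat) (U : set 'rV[R]_d.+1)
    (f : 'rV[R]_d.+1 -> R) : Prop := forall m, Ck m U f.

(** * Riemannian geometry in a coordinate patch

    [G x] is the Gram matrix of the metric in the coordinate frame at [x]. *)

Definition inner (R : realType) (d : nat) (A : 'M[R]_d) (u w : 'rV[R]_d) : R :=
  (u *m A *m w^T) 0 0.

Definition grad (R : realType) (d : nat) (G : 'rV[R]_d.+1 -> 'M[R]_d.+1)
    (f : 'rV[R]_d.+1 -> R) (x : 'rV[R]_d.+1) : 'rV[R]_d.+1 :=
  (\row_i pd i f x) *m invmx (G x).

(** [christoffel G a i j] is the symbol with upper index [a]. *)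
Definition christoffel (R : realType) (d : nat)
    (G : 'rV[R]_d.+1 -> 'M[R]_d.+1) (a i j : 'I_d.+1) (x : 'rV[R]_d.+1) : R :=
  2^-1 * \sum_b invmx (G x) a b *
    (pd i (fun y => G y j b) x + pd j (fun y => G y i b) x
     - pd b (fun y => G y i j) x).

Definition hess (R : realType) (d : nat) (G : 'rV[R]_d.+1 -> 'M[R]_d.+1)
    (f : 'rV[R]_d.+1 -> R) (x : 'rV[R]_d.+1) : 'M[R]_d.+1 :=
  \matrix_(i, j) (pd i (pd j f) x - \sum_a christoffel G a i j x * pd a f x).

(** Sign convention: the round sphere has positive Ricci curvature. *)
Definition ricci (R : realType) (d : nat) (G : 'rV[R]_d.+1 -> 'M[R]_d.+1)
    (x : 'rV[R]_d.+1) : 'M[R]_d.+1 :=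
  \matrix_(i, j) \sum_a
    (pd a (christoffel G a i j) x - pd i (christoffel G a a j) x
     + \sum_b (christoffel G a a b x * christoffel G b i j x
               - christoffel G a i b x * christoffel G b a j x)).

Definition bakry_emery (R : realType) (d : nat)
    (G : 'rV[R]_d.+1 -> 'M[R]_d.+1) (f : 'rV[R]_d.+1 -> R)
    (x : 'rV[R]_d.+1) : 'M[R]_d.+1 := ricci G x - hess G f x.

Definition laplacian (R : realType) (d : nat) (G : 'rV[R]_d.+1 -> 'M[R]_d.+1)
    (u : 'rV[R]_d.+1 -> R) (x : 'rV[R]_d.+1) : R :=
  \sum_i \sum_j invmx (G x) i j * hess G u x i j.

Definition weighted_laplacian (R : realType) (d : nat)
    (G : 'rV[R]_d.+1 -> 'M[R]_d.+1) (f u : 'rV[R]_d.+1 -> R)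
    (x : 'rV[R]_d.+1) : R :=
  laplacian G u x + inner (G x) (grad G f x) (grad G u x).

(** At a point of the boundary hyperplane with Gram matrix [A]. *)
Definition inner_unit_normal (R : realType) (d : nat) (A : 'M[R]_d.+1)
    (nu : 'rV[R]_d.+1) : Prop :=
  [/\ 0 < nu 0 ord0, inner A nu nu = 1 &
      forall w : 'rV[R]_d.+1, w 0 ord0 = 0 -> inner A nu w = 0].

(** <D_w W, eta> at a point of the boundary hyperplane, where [W] is the
    extension of [w] with constant components, which is tangent to the
    boundary when [w 0 ord0 = 0]. *)
Definition second_form (R : realType) (d : nat)
    (G : 'rV[R]_d.+1 -> 'M[R]_d.+1) (x eta w : 'rV[R]_d.+1) : R :=
  inner (G x)
    (\row_a \sum_i \sum_j christoffel G a i j x * w 0 i * w 0 j) eta.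

(** * Parametrized hypersurfaces

    [X] parametrizes a hypersurface of a patch with metric [G], and [N] gives
    the components of a vector field along [X]. *)

Definition coord_tangent (R : realType) (d e : nat)
    (X : 'rV[R]_d.+1 -> 'rV[R]_e.+1) (i : 'I_d.+1) (x : 'rV[R]_d.+1) :
    'rV[R]_e.+1 := \row_a pd i (fun y => X y 0 a) x.

Definition induced_metric (R : realType) (d e : nat)
    (G : 'rV[R]_e.+1 -> 'M[R]_e.+1) (X : 'rV[R]_d.+1 -> 'rV[R]_e.+1)
    (x : 'rV[R]_d.+1) : 'M[R]_d.+1 :=
  \matrix_(i, j) inner (G (X x)) (coord_tangent X i x) (coord_tangent X j x).

Definition cov_der (R : realType) (d e : nat)
    (G : 'rV[R]_e.+1 -> 'M[R]_e.+1) (X N : 'rV[R]_d.+1 -> 'rV[R]_e.+1)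
    (i : 'I_d.+1) (x : 'rV[R]_d.+1) : 'rV[R]_e.+1 :=
  \row_a (pd i (fun y => N y 0 a) x +
          \sum_b \sum_c christoffel G a b c (X x)
                        * coord_tangent X i x 0 b * N x 0 c).

Definition surface_div (R : realType) (d e : nat)
    (G : 'rV[R]_e.+1 -> 'M[R]_e.+1) (X N : 'rV[R]_d.+1 -> 'rV[R]_e.+1)
    (x : 'rV[R]_d.+1) : R :=
  \sum_i \sum_j invmx (induced_metric G X x) i j
                * inner (G (X x)) (cov_der G X N i x) (coord_tangent X j x).

Definition weighted_mean_curvature (R : realType) (d e : nat)
    (G : 'rV[R]_e.+1 -> 'M[R]_e.+1) (psi : 'rV[R]_e.+1 -> R)
    (X N : 'rV[R]_d.+1 -> 'rV[R]_e.+1) (x : 'rV[R]_d.+1) : R :=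
  - surface_div G X N x - inner (G (X x)) (grad G psi (X x)) (N x).

(** * Riemannian manifolds with (possibly empty) boundary *)

(** Charts take values in the half-space; [chart_inv k] is the inverse of the
    chart [chart k], meaningful only on [chart_image k].  Any smooth atlas is
    allowed, not only maximal ones; [chart_at] selects a chart around each
    point. *)
Record manifold (R : realType) (d : nat) := Manifold {
  carrier :> topologicalType;
  atlas : Type;
  chart_dom : atlas -> set carrier;
  chart : atlas -> carrier -> 'rV[R]_d.+1;
  chart_inv : atlas -> 'rV[R]_d.+1 -> carrier;
  chart_at : carrier -> atlas;
  carrier_hausdorff : hausdorff_space carrier;
  carrier_second_countable : @second_countable carrier;
  chart_at_dom : forall p, chart_dom (chart_at p) p;
  chart_dom_open : forall k, open (chart_dom k);
  chart_image_open : forall k, exists2 V : set 'rV[R]_d.+1,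
        open V & chart k @` chart_dom k = V `&` halfspace R d;
  chartK : forall k p, chart_dom k p -> chart_inv k (chart k p) = p;
  chart_continuous : forall k, {within chart_dom k, continuous (chart k)};
  chart_inv_continuous : forall k,
    {within chart k @` chart_dom k, continuous (chart_inv k)};
  transition_smooth : forall k l a,
    Cinfty ((chart k @` chart_dom k) `&` (chart_inv k @^-1` chart_dom l))
           (fun x => chart l (chart_inv k x) 0 a) }.

Definition chart_image (R : realType) (d : nat) (M : manifold R d)
  (k : atlas M) : set 'rV[R]_d.+1 := chart k @` chart_dom k.

(** The coordinates of the points of the boundary of [M] in the chart [k]. *)
Definition boundary_image (R : realType) (d : nat) (M : manifold R d)
  (k : atlas M) : set 'rV[R]_d.+1 :=
  chart_image k `&` [set x : 'rV[R]_d.+1 | x 0 ord0 = 0].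

Definition boundary (R : realType) (d : nat) (M : manifold R d) : set M :=
  [set p : M | exists k : atlas M, chart_dom k p /\ chart k p 0 ord0 = 0].
Arguments boundary {R d} M _.

Definition smooth (R : realType) (d : nat) (M : manifold R d) (f : M -> R) :
  Prop := forall k : atlas M, Cinfty (chart_image k) (f \o chart_inv k).

Definition C2 (R : realType) (d : nat) (M : manifold R d) (f : M -> R) :
  Prop := forall k : atlas M, Ck 2 (chart_image k) (f \o chart_inv k).

(** Entry [(i, a)] is the derivative along [i] of the coordinate [a] of the
    transition map from the chart [k] to the chart [l]. *)
Definition transition_jacobian (R : realType) (d : nat) (M : manifold R d)
    (k l : atlas M) (x : 'rV[R]_d.+1) : 'M[R]_d.+1 :=
  \matrix_(i, a) pd i (fun y => chart l (chart_inv k y) 0 a) x.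

Record riemannian (R : realType) (d : nat) := Riemannian {
  base :> manifold R d;
  gram : atlas base -> 'rV[R]_d.+1 -> 'M[R]_d.+1;
  gram_smooth : forall k i j, Cinfty (chart_image k) (fun x => gram k x i j);
  gram_sym : forall k x, chart_image k x -> (gram k x)^T = gram k x;
  gram_pos : forall k x, chart_image k x ->
    forall w : 'rV[R]_d.+1, w != 0 -> 0 < inner (gram k x) w w;
  gram_change : forall k l p, chart_dom k p -> chart_dom l p ->
        gram k (chart k p) =
        transition_jacobian k l (chart k p) *m gram l (chart l p)
          *m (transition_jacobian k l (chart k p))^T }.

(** [o k p] tells whether the coordinate frame of the chart [k] at [p] is
    positively oriented.  (Asking instead for an atlas with orientation
    preserving transitions would exclude compact intervals, as all charts
    have values in the same half-space.) *)
Definition is_orientation (R : realType) (d : nat) (M : manifold R d)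
    (o : atlas M -> M -> bool) : Prop :=
  (forall k, {within chart_dom k, continuous (o k)}) /\
  (forall k l p, chart_dom k p -> chart_dom l p ->
     (o k p == o l p) = (0 < \det (transition_jacobian k l (chart k p)))).

Definition C1_curve (R : realType) (d : nat) (M : manifold R d)
    (gamma : R -> M) : Prop :=
  {within `[0, 1], continuous gamma} /\
  forall (k : atlas M) (t : R) a, t \in `[0, 1] -> chart_dom k (gamma t) ->
    let f := fun s => chart k (gamma s) 0 a in
    derivable_in `[0, 1] f t /\
    der_in `[0, 1] f s @[s --> within `[0, 1] (nbhs t)]
      --> der_in `[0, 1] f t.

Definition speed (R : realType) (d : nat) (M : riemannian R d)
    (gamma : R -> M) (t : R) : R :=
  let k := chart_at (gamma t) in
  let w := \row_a der_in `[0, 1] (fun s => chart k (gamma s) 0 a) t in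
  Num.sqrt (inner (gram k (chart k (gamma t))) w w).

Definition curve_length (R : realType) (d : nat) (M : riemannian R d)
    (gamma : R -> M) : R :=
  Rintegral (@lebesgue_measure R) `[0, 1] (speed gamma).

(** C^1 curves and piecewise C^1 curves give the same infimum, since a
    piecewise C^1 curve can be reparametrized so as to stop at its corners. *)
Definition rdist (R : realType) (d : nat) (M : riemannian R d) (p q : M) : R :=
  inf [set curve_length gamma | gamma in
        [set gamma : R -> M | [/\ C1_curve gamma, gamma 0 = p & gamma 1 = q]]].

Definition complete_manifold (R : realType) (d : nat) (M : riemannian R d) :
    Prop :=
  forall u : nat -> M,
    (forall e : R, 0 < e -> exists n0 : nat, forall m n : nat,
       (n0 <= m)%N -> (n0 <= n)%N -> rdist (u m) (u n) < e) ->
    exists p : M, u @ \oo --> p.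

Definition bakry_emery_ge (R : realType) (d : nat) (M : riemannian R d)
    (h : M -> R) (c : R) : Prop :=
  forall (k : atlas M) x, chart_image k x -> forall w : 'rV[R]_d.+1,
    c * inner (gram k x) w w
    <= inner (bakry_emery (gram k) (h \o chart_inv k) x) w w.

Definition bakry_emery_gt (R : realType) (d : nat) (M : riemannian R d)
    (h : M -> R) (c : R) : Prop :=
  forall (k : atlas M) x, chart_image k x -> forall w : 'rV[R]_d.+1, w != 0 ->
    c * inner (gram k x) w w
    < inner (bakry_emery (gram k) (h \o chart_inv k) x) w w.

Definition locally_convex_boundary (R : realType) (d : nat)
    (M : riemannian R d) : Prop :=
  forall (k : atlas M) x (eta w : 'rV[R]_d.+1), boundary_image k x ->
    inner_unit_normal (gram k x) eta -> w 0 ord0 = 0 ->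
    0 <= second_form (gram k) x eta w.

Definition locally_strictly_convex_boundary (R : realType) (d : nat)
    (M : riemannian R d) : Prop :=
  forall (k : atlas M) x (eta w : 'rV[R]_d.+1), boundary_image k x ->
    inner_unit_normal (gram k x) eta -> w 0 ord0 = 0 -> w != 0 ->
    0 < second_form (gram k) x eta w.

(** * Riemannian cylinders and entire horizontal graphs

    A chart [k] of [M] gives the coordinates [row_mx x t] on the part of the
    cylinder over [chart_dom k]; the boundary of the cylinder, which lies over
    that of [M], still corresponds to the vanishing of the first coordinate. *)

Definition space_part (R : realType) (d : nat) (y : 'rV[R]_(d.+1 + 1)) :
  'rV[R]_d.+1 := lsubmx y.

Definition height (R : realType) (d : nat) (y : 'rV[R]_(d.+1 + 1)) : R :=
  rsubmx y 0 0.

Definition cyl_param (R : realType) (d : nat) (M : riemannian R d)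
    (k : atlas M) (y : 'rV[R]_(d.+1 + 1)) : M * R :=
  (chart_inv k (space_part y), height y).

Definition cyl_gram (R : realType) (d : nat) (M : riemannian R d)
    (k : atlas M) (y : 'rV[R]_(d.+1 + 1)) : 'M[R]_(d.+1 + 1) :=
  block_mx (gram k (space_part y)) 0 0 1%:M.

Definition slice (R : realType) (d : nat) (M : riemannian R d) (s : R) :
  set (M * R) := [set q : M * R | q.2 = s].
Arguments slice {R d} M s _.

Definition entire_graph (R : realType) (d : nat) (M : riemannian R d)
    (phi : M -> R) : set (M * R) := [set (p, phi p) | p in [set: M]].

Definition graph_param (R : realType) (d : nat) (M : riemannian R d)
    (phi : M -> R) (k : atlas M) (x : 'rV[R]_d.+1) : 'rV[R]_(d.+1 + 1) :=
  row_mx x (const_mx (phi (chart_inv k x))).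

Definition graph_normal (R : realType) (d : nat) (M : riemannian R d)
    (phi : M -> R) (k : atlas M) (x : 'rV[R]_d.+1) : 'rV[R]_(d.+1 + 1) :=
  let D := grad (gram k) (phi \o chart_inv k) x in
  (Num.sqrt (1 + inner (gram k x) D D))^-1 *: row_mx D (const_mx (- 1)).

Definition graph_gram (R : realType) (d : nat) (M : riemannian R d)
    (phi : M -> R) (k : atlas M) : 'rV[R]_d.+1 -> 'M[R]_d.+1 :=
  induced_metric (@cyl_gram R d M k) (graph_param phi k).

Definition constant_weighted_mean_curvature (R : realType) (d : nat)
    (M : riemannian R d) (psi : M * R -> R) (phi : M -> R) : Prop :=
  exists H : R, forall (k : atlas M) x, chart_image k x ->
    weighted_mean_curvature (@cyl_gram R d M k) (psi \o cyl_param k)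
      (graph_param phi k) (graph_normal phi k) x = H.

(** The boundary of an entire graph is automatically its intersection with
    the boundary of the cylinder, so only orthogonality remains. *)
Definition free_boundary (R : realType) (d : nat) (M : riemannian R d)
    (phi : M -> R) : Prop :=
  forall (k : atlas M) x (eta : 'rV[R]_(d.+1 + 1)), boundary_image k x ->
    inner_unit_normal (cyl_gram k (graph_param phi k x)) eta ->
    inner (cyl_gram k (graph_param phi k x)) (graph_normal phi k x) eta = 0.

(** Functions on the graph are identified with functions on [M] through
    the diffeomorphism [p |-> (p, phi p)]. *)
Definition weighted_parabolic (R : realType) (d : nat) (M : riemannian R d)
    (psi : M * R -> R) (phi : M -> R) : Prop :=
  forall u : M -> R, C2 u ->
    (exists B : R, forall p, u p <= B) ->
    (forall (k : atlas M) x, chart_image k x -> ~ boundary_image k x ->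
       0 <= weighted_laplacian (graph_gram phi k)
              (psi \o cyl_param k \o graph_param phi k) (u \o chart_inv k) x) ->
    (forall (k : atlas M) x nu, boundary_image k x ->
       inner_unit_normal (graph_gram phi k x) nu ->
       0 <= \sum_i nu 0 i * pd i (u \o chart_inv k) x) ->
    exists a : R, forall p, u p = a.

(* Main.v *)
(** Let [W = sqrt (1 + |grad phi|^2)] be the area element of the graph and let
    [theta = - 1 / W] be the component of the downward unit normal along the
    vertical direction.  Differentiating the equation [H_psi = H] for the weighted
    mean curvature in the direction of [grad phi], and combining it with Bochner's
    formula for [phi], gives on the graph, with metric [g] and weight [psi],
      [W^3 Delta_psi theta = Ric_h (grad phi, grad phi) + v''(phi) |grad phi|^2
                             + |Hess phi|_g^2],
    which is nonnegative because [Ric_h >= c >= - v''].  The free boundary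
    condition makes [grad phi] tangent to the boundary, and then the conormal
    derivative of [theta] is a positive multiple of the second fundamental form
    of the boundary evaluated at [grad phi].  As [theta <= 0], parabolicity makes
    [theta] constant, so that [|grad phi|] is constant and all the nonnegative
    terms above vanish.  Each of (i), (ii), (iii) then forces [grad phi = 0]: in
    case (iii) [Hess phi = 0], so the mean curvature equation says that [v'(phi)]
    is constant, whereas [v''(phi) = - c <> 0] wherever [grad phi <> 0]. *)

Require Import Defs.
From mathcomp Require Import all_boot all_order all_algebra.
From mathcomp Require Import all_classical all_reals all_analysis.
From mathcomp Require Import ring lra.
Import Order.TTheory GRing.Theory Num.Theory numFieldNormedType.Exports.

Set Implicit Arguments.
Unset Strict Implicit.
Unset Printing Implicit Defensive.

Local Open Scope classical_set_scope.
Local Open Scope ring_scope.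

(** * Calculus in the half-space *)

(** Functions on the graph are functions on [M], so the Laplacian of the graph is computed in a
    chart of [M]. There the metric of the graph is the rank-one perturbation [G + df^T df] of the
    metric [G] of [M], which makes its inverse and its Christoffel symbols explicit. Let
    [b = d |grad f|^2 / 2]. The Laplacian of theta then contains third derivatives of [f] only in
    the trace of the covariant derivative of [b] and in its value at [(grad f, grad f)]. Bochner's
    formula trades the trace for the derivative of the Laplacian of [f] along [grad f], and the
    differentiated mean curvature equation trades the latter for [W^-2] times the value at
    [(grad f, grad f)]. So the third-order terms cancel, and the remaining quadratic terms in
    [Hess f] assemble into its squared norm in the graph metric rather than in [G]. At boundary
    points derivatives across the boundary are one-sided. The chain rule and the symmetry of second
    derivatives are therefore obtained from mean values along axis-parallel segments that stay in
    the half-space. *)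

Section Derivative_in.
Variables (R : realType) (D : set R) (t : R).
Implicit Types f g : R -> R.

Lemma quotient_in_near f g : f t = g t ->
  (\forall s \near within D t^', f s = g s) ->
  quotient_in D f t --> quotient_in D g t.
Proof.
move=> fgt fg; apply: near_eq_cvg.
by apply: filterS fg => s fgs; rewrite fgs fgt.
Qed.

Lemma cvg_quotient_cst (a : R) : quotient_in D (fun=> a) t --> (0 : R).
Proof.
rewrite /quotient_in.
under eq_fun do rewrite subrr mul0r.
exact: cvg_cst.
Qed.

Lemma cvg_quotientD f g (a b : R) : quotient_in D f t --> a ->
  quotient_in D g t --> b -> quotient_in D (fun s => f s + g s) t --> a + b.
Proof.
move=> fa gb; rewrite /quotient_in.
under eq_fun do rewrite opprD addrACA mulrDl.
exact: cvgD.
Qed.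

Lemma quotient_in_continuous f (a : R) : quotient_in D f t --> a ->
  f s @[s --> within D t^'] --> f t.
Proof.
move=> fa.
have tt : (s : R) @[s --> within D t^'] --> t.
  by do 2 apply: (@cvg_within_filter _ _ id); exact: cvg_id.
have : (f s - f t) / (s - t) * (s - t) + f t @[s --> within D t^'] -->
    a * (t - t) + f t.
  apply: cvgD; last exact: cvg_cst.
  by apply: cvgM => //; apply: cvgB => //; exact: cvg_cst.
rewrite subrr mulr0 add0r; apply: cvg_trans; apply: near_eq_cvg.
rewrite near_withinE near_withinE; near=> s => st _.
by rewrite mulfVK ?subrK// subr_eq0.
Unshelve. all: end_near. Qed.

Lemma cvg_quotientM f g (a b : R) : quotient_in D f t --> a ->
  quotient_in D g t --> b ->
  quotient_in D (fun s => f s * g s) t --> a * g t + f t * b.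
Proof.
move=> fa gb; rewrite /quotient_in.
have E s : (f s * g s - f t * g t) / (s - t) =
    (f s - f t) / (s - t) * g t + f s * ((g s - g t) / (s - t)) by ring.
under eq_fun do rewrite E.
apply: cvgD; first by apply: cvgM => //; exact: cvg_cst.
by apply: cvgM => //; exact: quotient_in_continuous fa.
Qed.

(** Caratheodory's slope function for [g] avoids a division by [f s - f t], which may vanish for [s]
    arbitrarily close to [t]. *)
Lemma cvg_quotient_comp f (g : R -> R) (a b : R) : quotient_in D f t --> a ->
  is_derive (f t) 1 g b -> quotient_in D (g \o f) t --> b * a.
Proof.
move=> fa /is_derive1_caratheodory[k [gk ck <-]]; rewrite /quotient_in.
under eq_fun do rewrite /= gk -mulrA.
apply: cvgM => //.
by apply: cvg_comp (quotient_in_continuous fa) ck.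
Qed.

End Derivative_in.

Section Partial_derivative.
Variables (R : realType) (d : nat).
Local Notation V := 'rV[R]_d.+1.
Local Notation Hs := (halfspace R d).
Implicit Types (f g : V -> R) (x y : V) (i j : 'I_d.+1).

(** A relational form of [pd], needed because [lim] returns a default value when there is no limit.
    By [is_pdP] it determines [pd] at points of the half-space, where the filter is proper. *)
Definition is_pd i f x (l : R) : Prop :=
  quotient_in (axis_line i x @^-1` Hs) (f \o axis_line i x) 0 --> l.

Definition rel_open (U : set V) : Prop :=
  exists2 W : set V, open W & U = W `&` Hs.

Lemma axis_line0 i x : axis_line i x 0 = x.
Proof. by rewrite /axis_line scale0r addr0. Qed.

Lemma axis_lineD i x s t : axis_line i (axis_line i x s) t = axis_line i x (s + t).
Proof. by rewrite /axis_line -addrA -scalerDl. Qed.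

Lemma axis_lineC i j x s t :
  axis_line i (axis_line j x s) t = axis_line j (axis_line i x t) s.
Proof. by rewrite /axis_line addrAC. Qed.

Lemma axis_lineE i x s j : axis_line i x s 0 j = x 0 j + s * (j == i)%:R.
Proof. by rewrite /axis_line !mxE eqxx. Qed.

Lemma axis_line_continuous i x : continuous (axis_line i x).
Proof.
move=> s; apply: cvgD; first exact: cvg_cst.
by apply: cvgZr_tmp; exact: cvg_id.
Qed.

Lemma axis_filter_proper i x : Hs x ->
  ProperFilter (within (axis_line i x @^-1` Hs) 0^').
Proof.
move=> x0; apply: Build_ProperFilter_ex => P.
rewrite /dnbhs /within /= => /nbhs_ballP[e /= e0 eP].
(* The positive direction stays in the half-space even at a boundary point. *)
exists (e / 2); apply: eP.
- by rewrite /ball /= sub0r normrN gtr0_norm; lra.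
- by apply/eqP; lra.
- rewrite /preimage /halfspace /= axis_lineE addr_ge0 //.
  by rewrite mulr_ge0 ?ler0n//; lra.
Qed.

Lemma is_pdP i f x l : Hs x -> is_pd i f x l -> pd i f x = l.
Proof.
move=> x0 fl; have ? := axis_filter_proper i x0.
exact: cvg_lim.
Qed.

Lemma is_pd_has i f x l : is_pd i f x l -> has_pd i f x.
Proof. by move=> fl; apply/cvg_ex; exists l. Qed.

Lemma rel_open_near U i x : rel_open U -> U x ->
  \forall s \near within (axis_line i x @^-1` Hs) 0^', U (axis_line i x s).
Proof.
move=> [W oW ->] [Wx _]; rewrite near_withinE near_withinE.
have : \forall s \near (0 : R), W (axis_line i x s).
  apply: (axis_line_continuous (i := i) (x := x)).
  by rewrite axis_line0; exact: open_nbhs_nbhs.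
by apply: filterS => s Ws _ Hss; split.
Qed.

Lemma is_pd_eq U i f g x l : rel_open U -> U x -> {in U, f =1 g} ->
  is_pd i f x l -> is_pd i g x l.
Proof.
move=> oU Ux fg; apply: cvg_trans; apply: quotient_in_near.
  by rewrite /= axis_line0 fg// inE.
by apply: filterS (rel_open_near i oU Ux) => s Us; rewrite /= fg// inE.
Qed.

Lemma rel_open_sub U : rel_open U -> U `<=` Hs.
Proof. by move=> [W _ ->] x []. Qed.

Lemma is_pd_cst i x a : is_pd i (fun=> a) x 0.
Proof. exact: cvg_quotient_cst. Qed.

Lemma is_pdD i f g x a b : is_pd i f x a -> is_pd i g x b ->
  is_pd i (fun y => f y + g y) x (a + b).
Proof. exact: cvg_quotientD. Qed.

Lemma is_pdM i f g x a b : is_pd i f x a -> is_pd i g x b ->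
  is_pd i (fun y => f y * g y) x (a * g x + f x * b).
Proof.
move=> fa gb; have := cvg_quotientM fa gb.
by rewrite /= axis_line0.
Qed.

Lemma is_pd_comp i f (g : R -> R) x a b : is_pd i f x a ->
  is_derive (f x) 1 g b -> is_pd i (g \o f) x (b * a).
Proof.
move=> fa gb; apply: (cvg_quotient_comp (f := f \o axis_line i x)) => //.
by rewrite /= axis_line0.
Qed.

Lemma is_pd_sum (I : Type) (r : seq I) i (f : I -> V -> R) (a : I -> R) x :
  (forall k, is_pd i (f k) x (a k)) ->
  is_pd i (fun y => \sum_(k <- r) f k y) x (\sum_(k <- r) a k).
Proof.
move=> fa; elim: r => [|k r IH].
  under [X in is_pd _ X]eq_fun do rewrite big_nil.
  by rewrite big_nil; exact: is_pd_cst.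
under [X in is_pd _ X]eq_fun do rewrite big_cons.
by rewrite big_cons; exact: is_pdD.
Qed.

End Partial_derivative.

(** * Closure properties of functions of class C^m up to the boundary *)

Section Smoothness.
Variables (R : realType) (d : nat).
Local Notation V := 'rV[R]_d.+1.
Implicit Types (f g : V -> R) (x y : V) (i j : 'I_d.+1) (U : set V).

Lemma Ck_continuous m U f : Ck m U f -> {within U, continuous f}.
Proof. by case: m => [|m] []. Qed.

Lemma CkS m U f : Ck m.+1 U f -> Ck m U f.
Proof.
elim: m f => [|m IH] f [cf df]; first by split.
by split=> // i; have [hf pf] := df i; split=> //; exact: IH.
Qed.

Variable U : set V.
Hypothesis oU : rel_open U.

Lemma pd_in_eq i f g : {in U, f =1 g} -> (forall x, U x -> has_pd i f x) ->
  {in U, pd i f =1 pd i g}.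
Proof.
move=> fg hf x; rewrite inE => Ux; apply/esym/is_pdP.
  exact: (rel_open_sub oU).
by apply: (is_pd_eq oU Ux fg); exact: hf.
Qed.

Lemma Ck_eq m f g : {in U, f =1 g} -> Ck m U f -> Ck m U g.
Proof.
elim: m f g => [|m IH] f g fg [cf df]; split=> //.
- exact: subspace_eq_continuous fg cf.
- exact: subspace_eq_continuous fg cf.
- move=> i; have [hf pf] := df i; split.
    move=> x Ux; apply: is_pd_has.
    by apply: (is_pd_eq oU Ux fg); exact: hf.
  by apply: IH pf; exact: pd_in_eq.
Qed.

(** Any candidates [g i] for the partial derivatives may be used, so that the closure lemmas below
    can work with the explicit formulas of the product, quotient and root rules. *)
Lemma CkSI m f (g : 'I_d.+1 -> V -> R) : {within U, continuous f} ->
  (forall i x, U x -> is_pd i f x (g i x)) -> (forall i, Ck m U (g i)) ->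
  Ck m.+1 U f.
Proof.
move=> cf fg Cg; split=> // i; split.
  by move=> x Ux; apply: is_pd_has; exact: fg.
apply: Ck_eq (Cg i) => x; rewrite inE => Ux; apply/esym/is_pdP; last exact: fg.
exact: (rel_open_sub oU).
Qed.

Lemma Ck_is_pd m i f x : Ck m.+1 U f -> U x -> is_pd i f x (pd i f x).
Proof. by move=> [_ /(_ i)[hf _]] Ux; exact: hf. Qed.

Lemma Ck_cst m a : Ck m U (fun=> a).
Proof.
elim: m a => [|m IH] a; first by split=> //;
  apply/subspace_continuousP => x _; exact: cvg_cst.
apply: (@CkSI m _ (fun _ _ => 0)) => //.
  apply/subspace_continuousP => x _; exact: cvg_cst.
by move=> i x _; exact: is_pd_cst.
Qed.

Lemma CkD m f g : Ck m U f -> Ck m U g -> Ck m U (fun x => f x + g x).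
Proof.
have cD f' g' : {within U, continuous f'} -> {within U, continuous g'} ->
    {within U, continuous (fun x => f' x + g' x)}.
  by move=> cf cg x; exact: cvgD (cf x) (cg x).
elim: m f g => [|m IH] f g Cf Cg.
  by split=> //; exact: cD (proj1 Cf) (proj1 Cg).
apply: (@CkSI m _ (fun i x => pd i f x + pd i g x)).
- exact: cD (proj1 Cf) (proj1 Cg).
- by move=> i x Ux; apply: is_pdD; [exact: Ck_is_pd Cf Ux|exact: Ck_is_pd Cg Ux].
- by move=> i; apply: IH; [case: Cf => _ /(_ i)[]|case: Cg => _ /(_ i)[]].
Qed.

Lemma CkM m f g : Ck m U f -> Ck m U g -> Ck m U (fun x => f x * g x).
Proof.
have cM f' g' : {within U, continuous f'} -> {within U, continuous g'} ->
    {within U, continuous (fun x => f' x * g' x)}.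
  by move=> cf cg x; exact: cvgM (cf x) (cg x).
elim: m f g => [|m IH] f g Cf Cg.
  by split=> //; exact: cM (proj1 Cf) (proj1 Cg).
apply: (@CkSI m _ (fun i x => pd i f x * g x + f x * pd i g x)).
- exact: cM (proj1 Cf) (proj1 Cg).
- by move=> i x Ux; apply: is_pdM; [exact: Ck_is_pd Cf Ux|exact: Ck_is_pd Cg Ux].
- move=> i; apply: CkD; apply: IH; try exact: CkS.
    by case: Cf => _ /(_ i)[].
  by case: Cg => _ /(_ i)[].
Qed.

Lemma is_pdV i f x a : f x != 0 -> is_pd i f x a ->
  is_pd i (fun y => (f y)^-1) x (- a * ((f x)^-1 * (f x)^-1)).
Proof.
move=> fx0 fa; rewrite mulNr mulrC -mulNr.
apply: (is_pd_comp (g := GRing.inv)) => //.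
apply: is_derive_eq; first exact: (is_deriveV (f := id) fx0).
by rewrite /GRing.scale /= mulr1 -exprVn expr2.
Qed.

(** The derivative [- f' * (f^-1)^2] involves [f^-1] itself only without derivatives, so the
    induction hypothesis covers it. *)
Lemma CkV m f : (forall x, U x -> f x != 0) -> Ck m U f ->
  Ck m U (fun x => (f x)^-1).
Proof.
move=> f0; elim: m => [|m IH] Cf.
  split=> //; move: Cf => [/subspace_continuousP cf _].
  by apply/subspace_continuousP => x Ux; apply: cvgV; [exact: f0|exact: cf].
apply: (@CkSI m _ (fun i x => - pd i f x * ((f x)^-1 * (f x)^-1))).
- by apply: (Ck_continuous (m := m)); apply: IH; exact: CkS.
- by move=> i x Ux; apply: is_pdV; [exact: f0|exact: Ck_is_pd Cf Ux].
- move=> i; apply: (CkM (f := fun x => - pd i f x)).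
    apply: (@Ck_eq _ (fun x => -1 * pd i f x)) => [x _|]; first by rewrite mulN1r.
    by apply: CkM; [exact: Ck_cst|case: Cf => _ /(_ i)[]].
  by apply: CkM; apply: IH; exact: CkS.
Qed.

Lemma is_pd_sqrt i f x a : 0 < f x -> is_pd i f x a ->
  is_pd i (fun y => Num.sqrt (f y)) x (a * (2 * Num.sqrt (f x))^-1).
Proof.
move=> fx0 fa; rewrite mulrC.
by apply: (is_pd_comp (g := Num.sqrt)) => //; exact: is_derive1_sqrt.
Qed.

Lemma Ck_sqrt m f : (forall x, U x -> 0 < f x) -> Ck m U f ->
  Ck m U (fun x => Num.sqrt (f x)).
Proof.
move=> f0.
have cs : Ck 0 U f -> {within U, continuous (fun x => Num.sqrt (f x))}.
  move=> [/subspace_continuousP cf _].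
  apply/subspace_continuousP => x Ux; apply: (cvg_comp _ Num.sqrt (cf x Ux)).
  exact: sqrt_continuous.
elim: m => [|m IH] Cf; first by split=> //; exact: cs.
apply: (@CkSI m _ (fun i x => pd i f x * (2 * Num.sqrt (f x))^-1)).
- by apply: cs; split=> //; exact: Ck_continuous Cf.
- by move=> i x Ux; apply: is_pd_sqrt; [exact: f0|exact: Ck_is_pd Cf Ux].
- move=> i; apply: CkM; first by case: Cf => _ /(_ i)[].
  apply: CkV; first by move=> x Ux; rewrite mulf_neq0// gt_eqF// sqrtr_gt0 f0.
  by apply: CkM; [exact: Ck_cst|apply: IH; exact: CkS].
Qed.

Lemma Cinfty_eq f g : {in U, f =1 g} -> Cinfty U f -> Cinfty U g.
Proof. by move=> fg Cf m; exact: Ck_eq fg (Cf m). Qed.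

Lemma Cinfty_cst a : Cinfty U (fun=> a).
Proof. by move=> m; exact: Ck_cst. Qed.

Lemma CinftyD f g : Cinfty U f -> Cinfty U g -> Cinfty U (fun x => f x + g x).
Proof. by move=> Cf Cg m; exact: CkD. Qed.

Lemma CinftyM f g : Cinfty U f -> Cinfty U g -> Cinfty U (fun x => f x * g x).
Proof. by move=> Cf Cg m; exact: CkM. Qed.

Lemma CinftyN f : Cinfty U f -> Cinfty U (fun x => - f x).
Proof.
move=> Cf; apply: (@Cinfty_eq (fun x => -1 * f x)) => [x _|].
  by rewrite mulN1r.
by apply: CinftyM => //; exact: Cinfty_cst.
Qed.

Lemma CinftyV f : (forall x, U x -> f x != 0) -> Cinfty U f ->
  Cinfty U (fun x => (f x)^-1).
Proof. by move=> f0 Cf m; exact: CkV. Qed.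

Lemma Cinfty_sqrt f : (forall x, U x -> 0 < f x) -> Cinfty U f ->
  Cinfty U (fun x => Num.sqrt (f x)).
Proof. by move=> f0 Cf m; exact: Ck_sqrt. Qed.

Lemma Cinfty_pd i f : Cinfty U f -> Cinfty U (pd i f).
Proof. by move=> Cf m; case: (Cf m.+1) => _ /(_ i)[]. Qed.

Lemma Cinfty_is_pd i f x : Cinfty U f -> U x -> is_pd i f x (pd i f x).
Proof. by move=> Cf; exact: Ck_is_pd (Cf 1%N). Qed.

Lemma Cinfty_sum (I : Type) (r : seq I) (f : I -> V -> R) :
  (forall k, Cinfty U (f k)) -> Cinfty U (fun x => \sum_(k <- r) f k x).
Proof.
move=> Cf; elim: r => [|k r IH].
  under [X in Cinfty _ X]eq_fun do rewrite big_nil.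
  exact: Cinfty_cst.
under [X in Cinfty _ X]eq_fun do rewrite big_cons.
exact: CinftyD.
Qed.

Lemma Cinfty_prod (I : Type) (r : seq I) (f : I -> V -> R) :
  (forall k, Cinfty U (f k)) -> Cinfty U (fun x => \prod_(k <- r) f k x).
Proof.
move=> Cf; elim: r => [|k r IH].
  under [X in Cinfty _ X]eq_fun do rewrite big_nil.
  exact: Cinfty_cst.
under [X in Cinfty _ X]eq_fun do rewrite big_cons.
exact: CinftyM.
Qed.

Lemma Cinfty_det n (A : V -> 'M[R]_n) :
  (forall k l, Cinfty U (fun x => A x k l)) -> Cinfty U (fun x => \det (A x)).
Proof.
move=> CA; apply: Cinfty_sum => s.
by apply: CinftyM; [exact: Cinfty_cst|exact: Cinfty_prod].
Qed.

(** By Cramer's rule the entries are polynomials in those of [A] divided by the determinant. *)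
Lemma Cinfty_invmx n (A : V -> 'M[R]_n) (i j : 'I_n) :
  (forall x, U x -> A x \in unitmx) ->
  (forall k l, Cinfty U (fun x => A x k l)) ->
  Cinfty U (fun x => invmx (A x) i j).
Proof.
move=> uA CA.
apply: (@Cinfty_eq (fun x => (\det (A x))^-1 * \adj (A x) i j)).
  by move=> x; rewrite inE => Ux; rewrite /invmx uA// [RHS]mxE.
apply: CinftyM.
  apply: CinftyV; last exact: Cinfty_det.
  by move=> x /uA; rewrite unitmxE unitfE.
under [X in Cinfty _ X]eq_fun do rewrite mxE.
apply: CinftyM; first exact: Cinfty_cst.
apply: Cinfty_det => k l.
under [X in Cinfty _ X]eq_fun do rewrite !mxE.
exact: CA.
Qed.

End Smoothness.

Lemma cvg_within_near (T : Type) (W : topologicalType) (F : set_system T)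
    {FF : Filter F} (D : set T) (f : T -> W) (l : W) :
  (\forall x \near F, D x) -> f x @[x --> within D F] --> l ->
  f x @[x --> F] --> l.
Proof.
move=> nD fl P /fl; rewrite /within /fmap /= => nP.
by apply: filterS2 nD nP => x Dx; apply.
Qed.

(** * Mean values along coordinate axes *)

Section Half_space_calculus.
Variables (R : realType) (d : nat).
Local Notation V := 'rV[R]_d.+1.
Local Notation Hs := (halfspace R d).
Implicit Types (f g : V -> R) (x y : V) (i j : 'I_d.+1).

Lemma nbhs_boxP x (P : set V) : nbhs x P <->
  exists2 r : R, 0 < r & forall y, (forall a, `|y 0 a - x 0 a| < r) -> P y.
Proof.
split=> [/nbhs_ballP[r /= r0 rP]|[r r0 rP]].
  exists r => // y xy; apply: rP; split=> // a b; rewrite (ord1 a).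
  by rewrite /ball /= distrC.
apply/nbhs_ballP; exists r => //= y xy; apply: rP => a.
by have [_ /(_ 0 a)] := xy; rewrite /ball /= distrC.
Qed.

Variable U : set V.
Hypothesis oU : rel_open U.

(** Away from the boundary, or along it, the relative derivative is an ordinary two-sided one, to
    which the mean value theorem applies. *)
Lemma is_derive_axis i f x (s : R) : Ck 1 U f -> U (axis_line i x s) ->
  (i = ord0 -> 0 < x 0 ord0 + s) ->
  is_derive s 1 (f \o axis_line i x) (pd i f (axis_line i x s)).
Proof.
move=> Cf; set y := axis_line i x s => Uy y0.
have fy := Ck_is_pd (i := i) Cf Uy.
have nD : \forall t \near (0 : R), Hs (axis_line i y t).
  have [i0|i0] := eqVneq i ord0.
    near=> t; rewrite /halfspace /= /y !axis_lineE i0 eqxx !mulr1 -lerBlDl sub0r ltW//.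
    by near: t; apply: lt_nbhsr; rewrite oppr_lt0; exact: y0.
  near=> t; rewrite /halfspace /= axis_lineE eq_sym (negbTE i0) mulr0 addr0.
  exact: (rel_open_sub oU).
have cq : h^-1 *: ((f \o axis_line i x \o shift s) (h *: 1) -
    (f \o axis_line i x) s) @[h --> 0^'] --> pd i f y.
  have {}nD : \forall t \near 0^', Hs (axis_line i y t).
    by rewrite near_withinE; apply: filterS nD => t.
  apply: cvg_trans (cvg_within_near nD fy).
  apply: near_eq_cvg; near=> h.
  rewrite /= axis_line0 /y axis_lineD /GRing.scale /= mulr1 subr0 mulrC.
  by rewrite [s + h]addrC.
apply: DeriveDef; first by apply/cvg_ex; exists (pd i f y).
exact: cvg_lim cq.
Unshelve. all: end_near. Qed.

Lemma axis_continuous i f x (a b : R) : Ck 1 U f ->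
  (forall s, s \in `[a, b] -> U (axis_line i x s)) ->
  {within `[a, b], continuous (f \o axis_line i x)}.
Proof.
move=> /Ck_continuous/subspace_continuousP cf Uab.
apply/subspace_continuousP => s sab.
have h : axis_line i x t @[t --> within `[a, b] (nbhs s)] -->
    within U (nbhs (axis_line i x s)).
  move=> P nP.
  have nt : \forall t \near s, U (axis_line i x t) -> P (axis_line i x t).
    exact: (axis_line_continuous nP).
  have : \forall t \near s, t \in `[a, b] -> P (axis_line i x t).
    by apply: filterS nt => t tP tab; apply: tP; exact: Uab.
  exact.
exact: cvg_comp h (cf _ (Uab _ sab)).
Qed.

(** Only endpoints of the segment can lie on the boundary when the direction is [ord0], so the
    derivative is two-sided inside. The parameter [t * s] treats both signs of [s] at once. *)
Lemma segment_MVT i f x s : Ck 1 U f ->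
  (forall t, 0 <= t <= 1 -> U (axis_line i x (t * s))) ->
  exists2 t, 0 <= t <= 1 &
    f (axis_line i x s) - f x = pd i f (axis_line i x (t * s)) * s.
Proof.
move=> Cf Us.
have Hx : 0 <= x 0 ord0.
  have := rel_open_sub oU (Us 0 _); rewrite mul0r axis_line0.
  by apply; rewrite lexx ler01.
have Hxs : i = ord0 -> 0 <= x 0 ord0 + s.
  move=> i0; have := rel_open_sub oU (Us 1 _).
  by rewrite mul1r /halfspace /= axis_lineE i0 mulr1; apply; rewrite lexx ler01.
have [->|s0] := eqVneq s 0.
  by exists 0; rewrite ?lexx ?ler01// axis_line0 mulr0 subrr.
have E r : r = r / s * s by rewrite mulfVK.
have [sp|] := ltrP 0 s.
  have Us' r : r \in `[0, s] -> U (axis_line i x r).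
    rewrite in_itv /= => /andP[r0 rs]; rewrite (E r); apply: Us.
    by rewrite divr_ge0 ?(ltW sp)//= ler_pdivrMr// mul1r.
  have dr r : r \in `]0, s[ -> is_derive r 1 (f \o axis_line i x)
      (pd i f (axis_line i x r)).
    move=> r0s; apply: is_derive_axis => //.
      by apply: Us'; apply: subset_itv_oo_cc r0s.
    by move=> _; move: r0s; rewrite in_itv /= => /andP[r0 _]; exact: ltr_wpDl.
  have [c c0s] := MVT sp dr (axis_continuous Cf Us').
  rewrite /= axis_line0 subr0 {1}(E c) => ->; exists (c / s) => //.
  move: c0s; rewrite in_itv /= => /andP[c0 cs].
  by rewrite divr_ge0 ?ltW//= ltr_pdivrMr ?mul1r.
rewrite le_eqVlt (negbTE s0) /= => sn.
have Us' r : r \in `[s, 0] -> U (axis_line i x r).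
  rewrite in_itv /= => /andP[r0 rs]; rewrite (E r); apply: Us.
  by rewrite nmulr_lge0 ?invr_lt0// rs/= ler_ndivrMr// mul1r.
have dr r : r \in `]s, 0[ -> is_derive r 1 (f \o axis_line i x)
    (pd i f (axis_line i x r)).
  move=> r0s; apply: is_derive_axis => //.
    by apply: Us'; apply: subset_itv_oo_cc r0s.
  move=> /Hxs xs; move: r0s; rewrite in_itv /= => /andP[r0 _].
  by rewrite (le_lt_trans xs)// ltrD2l.
have [c c0s] := MVT sn dr (axis_continuous Cf Us').
rewrite /= axis_line0 sub0r {1}(E c) mulrN => /eqP.
rewrite -eqr_oppLR opprB => /eqP->; exists (c / s) => //.
move: c0s; rewrite in_itv /= => /andP[c0 cs].
rewrite nmulr_lge0 ?invr_lt0// (ltW cs)/= ler_ndivrMr// mul1r; exact: ltW.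
Qed.

End Half_space_calculus.

(** * First-order expansion, chain rule and symmetry of second derivatives *)

Section Half_space_expansion.
Variables (R : realType) (d : nat).
Local Notation V := 'rV[R]_d.+1.
Local Notation Hs := (halfspace R d).
Implicit Types (f g : V -> R) (x y : V) (i j : 'I_d.+1).
Variable U : set V.
Hypothesis oU : rel_open U.

Lemma rel_open_box x : U x -> exists2 r : R, 0 < r &
  forall y, Hs y -> (forall a, `|y 0 a - x 0 a| < r) -> U y.
Proof.
case: oU => W oW -> [Wx _].
have /nbhs_boxP[r r0 rW] : nbhs x W by exact: open_nbhs_nbhs.
by exists r => // y Hy xy; split=> //; exact: rW.
Qed.

Lemma Ck_box m f x (e : R) : Ck m U f -> U x -> 0 < e -> exists2 r : R, 0 < r &
  forall y, Hs y -> (forall a, `|y 0 a - x 0 a| < r) ->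
    U y /\ `|f y - f x| < e.
Proof.
move=> /Ck_continuous/subspace_continuousP cf Ux e0.
have := cf _ Ux; move/cvgrPdist_lt => /(_ e e0).
rewrite near_withinE => /nbhs_boxP[r r0 rf].
have [r' r'0 rU] := rel_open_box Ux.
exists (Num.min r r'); first by rewrite lt_min r0.
move=> y Hy xy.
have Uy : U y.
  by apply: rU => // a; have := xy a; rewrite lt_min => /andP[].
split=> //; rewrite distrC; apply: rf => // a.
by have := xy a; rewrite lt_min => /andP[].
Qed.

Lemma Ck1_box f x (e : R) : Ck 1 U f -> U x -> 0 < e ->
  exists2 r : R, 0 < r &
  forall y, Hs y -> (forall a, `|y 0 a - x 0 a| < r) ->
    U y /\ forall i, `|pd i f y - pd i f x| < e.
Proof.
move=> [_ Cf] Ux e0.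
have /choice[r rP] : forall i, exists r : R, 0 < r /\
    forall y, Hs y -> (forall a, `|y 0 a - x 0 a| < r) ->
    U y /\ `|pd i f y - pd i f x| < e.
  by move=> i; have [r r0 rP] := Ck_box (m := 0) (Cf i).2 Ux e0; exists r.
have [s [s0 sr]] : exists s : R, 0 < s /\ forall i, s <= r i.
  exists (\big[Num.min/1]_i r i); split; last by move=> i; exact: bigmin_le.
  by apply: lt_bigmin => [|i _]; [exact: ltr01|case: (rP i)].
exists s => // y Hy xy; split=> [|i].
  by have [_ /(_ y Hy)[]] := rP ord0 => // a; exact: lt_le_trans (xy a) (sr _).
by have [_ /(_ y Hy)[]] := rP i => // a; exact: lt_le_trans (xy a) (sr _).
Qed.

(** Moving one coordinate after the other stays in the half-space. *)
Lemma Ck1_expansion f x (e : R) : Ck 1 U f -> U x -> 0 < e ->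
  exists2 r : R, 0 < r &
  forall y, Hs y -> (forall a, `|y 0 a - x 0 a| < r) ->
  exists2 k : 'I_d.+1 -> R,
    forall i, (exists2 z, U z & k i = pd i f z) /\ `|k i - pd i f x| < e &
    f y - f x = \sum_i k i * (y 0 i - x 0 i).
Proof.
move=> Cf Ux e0; have [r r0 rf] := Ck1_box Cf Ux e0.
exists r => // y Hy xy.
(* The path from [x] to [y]: the first [n] coordinates have already been replaced by those of
   [y]. *)
pose hyb n : V := \row_a (if (a < n)%N then y 0 a else x 0 a).
have hybS (i : 'I_d.+1) : hyb i.+1 = axis_line i (hyb i) (y 0 i - x 0 i).
  apply/rowP => a; rewrite axis_lineE !mxE ltnS leq_eqVlt.
  have [->|/negbTE ai] := eqVneq a i; first by rewrite eqxx ltnn /= mulr1 addrC subrK.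
  by rewrite [(_ == _ :> nat)]ai /= mulr0 addr0.
have Hx : Hs x by exact: (rel_open_sub oU).
(* Every coordinate along the path lies between those of [x] and [y], so neither the half-space nor
   the box is left. *)
have seg (i : 'I_d.+1) t : 0 <= t <= 1 ->
    Hs (axis_line i (hyb i) (t * (y 0 i - x 0 i))) /\
    forall a, `|axis_line i (hyb i) (t * (y 0 i - x 0 i)) 0 a - x 0 a| < r.
  move=> /andP[t0 t1].
  have E a : exists2 s, 0 <= s <= 1 &
      axis_line i (hyb i) (t * (y 0 i - x 0 i)) 0 a =
      x 0 a + s * (y 0 a - x 0 a).
    rewrite axis_lineE !mxE; have [->|ai] := eqVneq a i.
      by rewrite ltnn mulr1; exists t; rewrite ?t0.
    rewrite mulr0 addr0; case: ifP => _.
      by exists 1; rewrite ?lexx ?ler01// mul1r addrC subrK.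
    by exists 0; rewrite ?lexx ?ler01// mul0r addr0.
  split=> [|a].
    rewrite /halfspace /=; have [s /andP[s0 s1] ->] := E ord0.
    by move: Hx Hy; rewrite /halfspace /= => Hx Hy; nra.
  have [s /andP[s0 s1] ->] := E a.
  rewrite addrC addrA addNr add0r normrM (ger0_norm s0).
  by apply: le_lt_trans (xy a); rewrite ler_piMl.
have /choice[k kP] : forall i : 'I_d.+1, exists k,
    ((exists2 z, U z & k = pd i f z) /\ `|k - pd i f x| < e) /\
    f (hyb i.+1) - f (hyb i) = k * (y 0 i - x 0 i).
  move=> i; rewrite hybS.
  have [|t t01 ->] := @segment_MVT _ _ _ oU i f (hyb i) (y 0 i - x 0 i) Cf.
    by move=> t /(seg i)[Hz xz]; have [] := rf _ Hz xz.
  exists (pd i f (axis_line i (hyb i) (t * (y 0 i - x 0 i)))).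
  have [Hz xz] := seg i t t01; have [Uz fz] := rf _ Hz xz.
  by split=> //; split=> //; eexists; first exact: Uz.
exists k => [i|]; first by case: (kP i).
have -> : f y - f x = f (hyb d.+1) - f (hyb 0).
  congr (f _ - f _); apply/rowP => a; rewrite mxE ?ltn_ord//.
rewrite -(@telescope_sumr _ 0 d.+1 (fun n => f (hyb n)))// big_mkord.
by apply: eq_bigr => i _; case: (kP i).
Qed.

Lemma locally_constant f x : Ck 1 U f -> U x ->
  (forall i y, U y -> pd i f y = 0) -> exists2 r : R, 0 < r &
  forall y, Hs y -> (forall a, `|y 0 a - x 0 a| < r) -> f y = f x.
Proof.
move=> Cf Ux f0; have [r r0 rf] := Ck1_expansion Cf Ux ltr01.
exists r => // y Hy xy; apply/eqP; rewrite -subr_eq0; apply/eqP.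
have [k kP ->] := rf y Hy xy.
by apply: big1 => i _; have [[z Uz ->] _] := kP i; rewrite f0// mul0r.
Qed.

(** The coefficients of the expansion tend to the partial derivatives at [c t], while the difference
    quotients of the components stay bounded. The curve only has to remain in the half-space near
    [t], which allows it to start on the boundary. *)
Lemma chain_rule f (D : set R) (t : R) (c : R -> V) (l : 'I_d.+1 -> R) :
  Ck 1 U f -> U (c t) -> (\forall s \near within D t^', Hs (c s)) ->
  (forall i, quotient_in D (fun s => c s 0 i) t --> l i) ->
  quotient_in D (f \o c) t --> \sum_i pd i f (c t) * l i.
Proof.
move=> Cf Ux Hc cl; set x := c t in Ux *.
pose q i s := (c s 0 i - c t 0 i) / (s - t).
have S0 : \sum_i pd i f x * q i s @[s --> within D t^'] -->
    \sum_i pd i f x * l i.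
  apply: cvg_big; first exact: add_continuous.
  by move=> i _; apply: cvgM; [exact: cvg_cst|exact: cl].
have D0 : (f (c s) - f x) / (s - t) - \sum_i pd i f x * q i s
    @[s --> within D t^'] --> (0 : R).
  apply/cvgrPdist_lt => e e0.
  (* Near [t] the sum of the [|q i s|] is at most [B]. Coefficients within [e / (1 + B)] of their
     limits thus give an error below [e]; the summand 1 makes this strict. *)
  pose B := \sum_i (`|l i| + 1).
  have B0 : 0 < 1 + B.
    by rewrite ltr_pwDl// sumr_ge0// => i _; rewrite addr_ge0.
  have e'0 : 0 < e / (1 + B) by rewrite divr_gt0.
  have [r r0 rf] := Ck1_expansion Cf Ux e'0.
  have nq i : \forall s \near within D t^', `|q i s| <= `|l i| + 1.
    have /cvgrPdist_lt/(_ 1 ltr01) := cl i; apply: filterS => s; rewrite -/(q i s).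
    move=> h; rewrite -lerBlDl; apply: le_trans (ltW h).
    by rewrite distrC; exact: lerB_dist.
  have nc i : \forall s \near within D t^', `|c s 0 i - x 0 i| < r.
    have /cvgrPdist_lt/(_ r r0) := quotient_in_continuous (cl i).
    by apply: filterS => s; rewrite distrC.
  near=> s.
  have Hcs : Hs (c s) by near: s.
  have xs : forall a, `|c s 0 a - x 0 a| < r by near: s; exact: filter_forall.
  have qs : forall a, `|q a s| <= `|l a| + 1 by near: s; exact: filter_forall.
  have [k kP ->] := rf (c s) Hcs xs.
  rewrite sub0r normrN mulr_suml -sumrB.
  have -> : \sum_i (k i * (c s 0 i - x 0 i) / (s - t) - pd i f x * q i s) =
      \sum_i (k i - pd i f x) * q i s.
    by apply: eq_bigr => i _; rewrite /q -/x; ring.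
  apply: le_lt_trans (ler_norm_sum _ _ _) _.
  apply: (@le_lt_trans _ _ (\sum_i (e / (1 + B)) * (`|l i| + 1))).
    apply: ler_sum => i _; rewrite normrM; apply: ler_pM => //.
    by case: (kP i) => _ /ltW.
  rewrite -mulr_sumr -/B -mulrA gtr_pMr// mulrC ltr_pdivrMr// mul1r.
  by rewrite ltrDr.
rewrite /quotient_in -[X in _ --> X]add0r.
apply: cvg_trans (cvgD D0 S0); apply: near_eq_cvg.
by near=> s; rewrite /= subrK.
Unshelve. all: end_near. Qed.

(** The mean value theorem in direction [i] is applied to the increment in direction [j], then in
    direction [j] to [pd i f]. Both displacements are nonnegative, which keeps the square in the
    half-space even when [x] is on the boundary. *)
Lemma second_difference i j f x (s : R) : i != j -> Ck 2 U f -> 0 < s ->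
  (forall p q, 0 <= p <= s -> 0 <= q <= s -> U (axis_line j (axis_line i x p) q)) ->
  exists p q, [/\ 0 <= p <= s, 0 <= q <= s &
    f (axis_line j (axis_line i x s) s) - f (axis_line i x s)
    - (f (axis_line j x s) - f x) =
    pd j (pd i f) (axis_line j (axis_line i x p) q) * s * s].
Proof.
move=> ij Cf s0 Us.
have C1 : Ck 1 U f by exact: CkS.
have s01 : 0 <= s <= s by rewrite lexx ltW.
have z01 : (0 : R) <= 0 <= s by rewrite lexx ltW.
have Ui p : p \in `[0, s] -> U (axis_line i x p).
  by rewrite in_itv => ps; have := Us p 0 ps z01; rewrite axis_line0.
have Uij p : p \in `[0, s] -> U (axis_line i (axis_line j x s) p).
  by rewrite in_itv => ps; rewrite axis_lineC; exact: Us.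
have Hx : 0 <= x 0 ord0.
  by have := rel_open_sub oU (Ui 0 _); rewrite axis_line0 in_itv; exact.
pose g p := f (axis_line i (axis_line j x s) p) - f (axis_line i x p).
have dg p : p \in `]0, s[ -> is_derive p 1 g
    (pd i f (axis_line i (axis_line j x s) p) - pd i f (axis_line i x p)).
  move=> ps; have ps' : p \in `[0, s] by exact: subset_itv_oo_cc ps.
  have p0 : 0 < p by move: ps; rewrite in_itv /= => /andP[].
  apply: (is_deriveB (f := f \o axis_line i (axis_line j x s))
                     (g := f \o axis_line i x)).
    apply: (is_derive_axis oU C1); first exact: Uij.
    move=> i0; rewrite axis_lineE -i0 (negbTE ij) mulr0 addr0 i0.
    exact: ltr_wpDl.
  by apply: (is_derive_axis oU C1); [exact: Ui|move=> _; exact: ltr_wpDl].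
have cg : {within `[0, s], continuous g}.
  have c1 := axis_continuous C1 Uij; have c2 := axis_continuous C1 Ui.
  by move=> p; exact: cvgB (c1 p) (c2 p).
have [p ps] := MVT s0 dg cg.
rewrite /g !(axis_lineC i j) !axis_line0 subr0 => E.
have {}ps : 0 <= p <= s.
  by move: ps; rewrite in_itv /= => /andP[? ?]; rewrite !ltW.
have ts t : 0 <= t <= 1 -> 0 <= t * s <= s.
  by move=> /andP[t0 t1]; rewrite mulr_ge0 ?(ltW s0)//= ler_piMl// ltW.
have [|t /ts t01] := @segment_MVT _ _ _ oU j (pd i f) (axis_line i x p) s
    (Cf.2 i).2.
  by move=> t /ts t01; exact: Us.
move=> E2; exists p, (t * s); split=> //.
by rewrite -E2 -E; ring.
Qed.

(** The same second difference, taken in the two orders, equals [s^2] times either mixed derivative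
    at points near [x]. Two different values at [x] would contradict continuity. *)
Lemma clairaut i j f x : Ck 2 U f -> U x -> pd i (pd j f) x = pd j (pd i f) x.
Proof.
move=> Cf Ux; have [->//|ij] := eqVneq i j.
apply/eqP; rewrite -subr_eq0 -normr_eq0; apply/negPn/negP => n0.
set e := `| _ | in n0.
have e0 : 0 < e / 2 by rewrite divr_gt0// lt_def n0 normr_ge0.
have [r1 r10 rf1] := Ck1_box (Cf.2 j).2 Ux e0.
have [r2 r20 rf2] := Ck1_box (Cf.2 i).2 Ux e0.
pose s := Num.min r1 r2 / 2.
have m0 : 0 < Num.min r1 r2 by rewrite lt_min r10.
have s0 : 0 < s by rewrite divr_gt0.
have sm : s < Num.min r1 r2 by rewrite ltr_pdivrMr// ltr_pMr// ltr1n.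
have Hx : 0 <= x 0 ord0 by exact: (rel_open_sub oU).
have box k l p q : k != l -> 0 <= p <= s -> 0 <= q <= s ->
    Hs (axis_line l (axis_line k x p) q) /\
    forall a, `|axis_line l (axis_line k x p) q 0 a - x 0 a| < Num.min r1 r2.
  move=> kl /andP[p0 ps] /andP[q0 qs]; split=> [|a].
    by rewrite /halfspace /= !axis_lineE !addr_ge0 ?mulr_ge0.
  rewrite !axis_lineE addrC !addrA addNr add0r.
  have [->|ak] := eqVneq a k.
    by rewrite (negbTE kl) mulr1 mulr0 addr0 ger0_norm// (le_lt_trans ps).
  rewrite mulr0 add0r; case: (a == l); rewrite ?mulr1 ?mulr0 ?normr0//.
  by rewrite ger0_norm// (le_lt_trans qs).
have m1 a : a < Num.min r1 r2 -> a < r1 by rewrite lt_min => /andP[].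
have m2 a : a < Num.min r1 r2 -> a < r2 by rewrite lt_min => /andP[].
have U1 k l : k != l -> forall p q, 0 <= p <= s -> 0 <= q <= s ->
    U (axis_line l (axis_line k x p) q).
  move=> kl p q ps qs; have [Hz xz] := box k l p q kl ps qs.
  by have [] := rf1 _ Hz (fun a => m1 _ (xz a)).
have [p [q [ps qs E]]] := second_difference ij Cf s0 (U1 _ _ ij).
have ji : j != i by rewrite eq_sym.
have [p' [q' [ps' qs' E']]] := second_difference ji Cf s0 (U1 _ _ ji).
have : pd j (pd i f) (axis_line j (axis_line i x p) q) =
    pd i (pd j f) (axis_line i (axis_line j x p') q').
  have sn0 : s != 0 by rewrite gt_eqF.
  apply: (mulIf sn0); apply: (mulIf sn0).
  apply: etrans (esym E) _; apply: etrans E'.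
  by rewrite (axis_lineC j i); ring.
have [Hz xz] := box i j p q ij ps qs.
have [_ /(_ j)] := rf2 _ Hz (fun a => m2 _ (xz a)).
have [Hz' xz'] := box j i p' q' ji ps' qs'.
have [_ /(_ i)] := rf1 _ Hz' (fun a => m1 _ (xz' a)).
move=> h1 h2 EE; rewrite EE in h2.
have tri (a b z : R) : `|z - a| < e / 2 -> `|z - b| < e / 2 -> `|a - b| < e.
  move=> za zb; rewrite [e]splitr; apply: le_lt_trans (ltrD za zb).
  by rewrite (distrC z a); exact: ler_distD.
have : e < e by exact: tri h1 h2.
by rewrite ltxx.
Qed.

End Half_space_expansion.

(** * Linear algebra *)

Section Positive_forms.
Variable R : realType.

Lemma innerE n (A : 'M[R]_n) (u w : 'rV_n) :
  inner A u w = \sum_i \sum_j u 0 i * A i j * w 0 j.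
Proof.
rewrite /inner mxE exchange_big; apply: eq_bigr => j _ /=.
by rewrite mxE mulr_suml; apply: eq_bigr => i _; rewrite !mxE.
Qed.

Lemma inner_sym n (A : 'M[R]_n) (u w : 'rV_n) : A^T = A ->
  inner A u w = inner A w u.
Proof.
move=> sA; rewrite /inner -[in RHS]sA -[w in RHS]trmxK -!trmx_mul [RHS]mxE.
by rewrite mulmxA.
Qed.

Lemma posdef_unit n (A : 'M[R]_n) :
  (forall w : 'rV_n, w != 0 -> 0 < inner A w w) -> A \in unitmx.
Proof.
move=> pA; rewrite -row_free_unit -kermx_eq0; apply/eqP/row_matrixP => i.
apply/eqP/negPn/negP; rewrite row0 => /pA.
by rewrite /inner -row_mul mulmx_ker row0 mul0mx mxE ltxx.
Qed.

(** Induction through the Schur complement [S] of the first diagonal entry. *)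
Lemma cholesky n (A : 'M[R]_n) : A^T = A ->
  (forall w : 'rV_n, w != 0 -> 0 < inner A w w) ->
  exists C : 'M[R]_n, A = C *m C^T.
Proof.
elim: n A => [|n IH]; first by move=> A _ _; exists 0; apply/matrixP => -[].
change n.+1 with (1 + n)%N => A sA pA.
pose a := A 0 0; pose r : 'rV[R]_n := ursubmx A; pose B : 'M[R]_n := drsubmx A.
have EA : A = block_mx a%:M r r^T B.
  rewrite -[LHS](submxK A) -/r -/B; congr block_mx.
    by apply/matrixP => i j; rewrite !ord1 !mxE !lshift0 eqxx mulr1n.
  by rewrite /r trmx_ursub sA.
have a0 : 0 < a.
  have := pA (delta_mx 0 0); rewrite /inner -rowE trmx_delta -colE !mxE; apply.
  by apply/eqP => /rowP/(_ 0)/eqP; rewrite !mxE !eqxx oner_eq0.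
have sB : B^T = B by rewrite /B trmx_drsub sA.
pose S := B - a^-1 *: (r^T *m r).
have [||C EC] := IH S.
- by rewrite /S linearB /= linearZ /= trmx_mul trmxK sB.
- move=> w w0.
  (* This first coordinate minimizes the form of [A] on the vectors [row_mx t w], and the minimum is
     the form of [S] at [w]. *)
  pose t := (- a^-1) *: (w *m r^T).
  have /pA : row_mx t w != 0.
    by apply: contraNneq w0 => /eqP; rewrite row_mx_eq0 => /andP[_ ->].
  rewrite /inner EA mul_row_block tr_row_mx mul_row_col.
  rewrite mulmxDl mulmxDl /t.
  rewrite -!scalemxAl mul_mx_scalar -scalemxAl scalerA mulNr.
  rewrite mulVf ?gt_eqF// scaleN1r addNr add0r scaleNr.
  by rewrite /S mulmxBr mulmxBl -scalemxAr -scalemxAl !mulmxA addrC.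
have sa : Num.sqrt a * Num.sqrt a = a by rewrite -expr2 sqr_sqrtr// ltW.
exists (block_mx (Num.sqrt a)%:M 0 ((Num.sqrt a)^-1 *: r^T) C).
rewrite tr_block_mx mulmx_block EA !trmx0 !mulmx0 !mul0mx !addr0.
rewrite tr_scalar_mx linearZ /= trmxK -EC.
have q0 : Num.sqrt a != 0 by rewrite gt_eqF// sqrtr_gt0.
congr block_mx.
- by rewrite -scalar_mxM sa.
- by rewrite mul_scalar_mx scalerA divff// scale1r.
- by rewrite mul_mx_scalar scalerA divff// scale1r.
- by rewrite -scalemxAl -scalemxAr scalerA -invfM sa /S addrC subrK.
Qed.

Lemma mxtrace_sqr_ge0 m n (K : 'M[R]_(m, n)) : 0 <= \tr (K *m K^T).
Proof.
apply: sumr_ge0 => i _; rewrite mxE; apply: sumr_ge0 => j _.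
by rewrite mxE -expr2 sqr_ge0.
Qed.

Lemma mxtrace_sqr_eq0 m n (K : 'M[R]_(m, n)) : \tr (K *m K^T) = 0 -> K = 0.
Proof.
move/eqP; rewrite psumr_eq0 => [/allP K0|i _]; last first.
  by rewrite mxE sumr_ge0// => j _; rewrite mxE -expr2 sqr_ge0.
apply/matrixP => i j; have /implyP/(_ isT) := K0 i (mem_index_enum _).
rewrite mxE psumr_eq0 => [/allP/(_ j (mem_index_enum _))|k _].
  by rewrite !mxE mulf_eq0 orbb => /eqP.
by rewrite mxE -expr2 sqr_ge0.
Qed.

(** [g = C C^T] turns [\tr (g^-1 F g^-1 F)] into the squared Frobenius norm of
    [C^-1 F C^-T]. *)
Lemma mxtrace_metric_sqr n (g F : 'M[R]_n) : g^T = g -> F^T = F ->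
  (forall w : 'rV_n, w != 0 -> 0 < inner g w w) ->
  exists2 K : 'M[R]_n, \tr (invmx g *m F *m invmx g *m F) = \tr (K *m K^T) &
    K = 0 -> F = 0.
Proof.
move=> sg sF pg; have [C EC] := cholesky sg pg.
have ug := posdef_unit pg.
have uC : C \in unitmx by move: ug; rewrite EC unitmx_mul => /andP[].
have uCt : C^T \in unitmx by rewrite unitmx_tr.
exists (invmx C *m F *m invmx C^T).
  have -> : invmx g = invmx C^T *m invmx C.
    apply: (can_inj (mulKmx ug)).
    by rewrite mulmxV// EC -mulmxA mulKVmx// mulmxV.
  rewrite !trmx_mul sF -!trmx_inv trmxK.
  rewrite -!mulmxA mxtrace_mulC !mulmxA.
  done.
move=> K0.
by rewrite -[F](mulKVmx uC) -[invmx C *m F](mulmxKV uCt) K0 mul0mx mulmx0.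
Qed.

End Positive_forms.

(** * Tensor calculus in a chart *)

Section Matrix_derivative.
Variables (R : realType) (d : nat).
Local Notation V := 'rV[R]_d.+1.
Local Notation Hs := (halfspace R d).
Implicit Types (x y : V) (k : 'I_d.+1).

Definition is_dm m n k (A : V -> 'M[R]_(m, n)) x (B : 'M[R]_(m, n)) : Prop :=
  forall i j, is_pd k (fun y => A y i j) x (B i j).

Definition dm m n k (A : V -> 'M[R]_(m, n)) x : 'M[R]_(m, n) :=
  \matrix_(i, j) pd k (fun y => A y i j) x.

Definition smooth_mx m n (U : set V) (A : V -> 'M[R]_(m, n)) : Prop :=
  forall i j, Cinfty U (fun y => A y i j).

Lemma is_dmM m n q k (A : V -> 'M[R]_(m, n)) (B : V -> 'M[R]_(n, q)) x A' B' :
  is_dm k A x A' -> is_dm k B x B' ->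
  is_dm k (fun y => A y *m B y) x (A' *m B x + A x *m B').
Proof.
move=> dA dB i j; rewrite !mxE -big_split /=.
under [X in is_pd _ X]eq_fun do rewrite mxE.
by apply: is_pd_sum => l; exact: is_pdM.
Qed.

Lemma is_dm_tr m n k (A : V -> 'M[R]_(m, n)) x A' :
  is_dm k A x A' -> is_dm k (fun y => (A y)^T) x A'^T.
Proof.
move=> dA i j; rewrite mxE.
under [X in is_pd _ X]eq_fun do rewrite mxE.
exact: dA.
Qed.

Lemma is_dm_unique m n k (A : V -> 'M[R]_(m, n)) x B C : Hs x ->
  is_dm k A x B -> is_dm k A x C -> B = C.
Proof.
by move=> Hx dB dC; apply/matrixP => i j;
  rewrite -(is_pdP Hx (dB i j)) (is_pdP Hx (dC i j)).
Qed.

Lemma is_dm_cst m n k (A : 'M[R]_(m, n)) x : is_dm k (fun=> A) x 0.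
Proof. by move=> i j; rewrite mxE; exact: is_pd_cst. Qed.

Lemma is_pd_trace n k (A : V -> 'M[R]_n) x A' :
  is_dm k A x A' -> is_pd k (fun y => \tr (A y)) x (\tr A').
Proof. by move=> dA; apply: (is_pd_sum (f := fun i y => A y i i)). Qed.

Section On_open.
Variable U : set V.
Hypothesis oU : rel_open U.

Lemma is_dm_eq m n k (A B : V -> 'M[R]_(m, n)) x A' : U x -> {in U, A =1 B} ->
  is_dm k A x A' -> is_dm k B x A'.
Proof.
move=> Ux AB dA i j; apply: (is_pd_eq oU Ux) (dA i j) => y Uy.
by rewrite AB.
Qed.

Lemma smooth_is_dm m n k (A : V -> 'M[R]_(m, n)) x : smooth_mx U A -> U x ->
  is_dm k A x (dm k A x).
Proof. by move=> sA Ux i j; rewrite mxE; exact: Cinfty_is_pd. Qed.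

Lemma smooth_mxM m n q (A : V -> 'M[R]_(m, n)) (B : V -> 'M[R]_(n, q)) :
  smooth_mx U A -> smooth_mx U B -> smooth_mx U (fun y => A y *m B y).
Proof.
move=> sA sB i j.
under [X in Cinfty _ X]eq_fun do rewrite mxE.
by apply: Cinfty_sum => // l; exact: CinftyM.
Qed.

Lemma smooth_mx_tr m n (A : V -> 'M[R]_(m, n)) :
  smooth_mx U A -> smooth_mx U (fun y => (A y)^T).
Proof.
move=> sA i j; under [X in Cinfty _ X]eq_fun do rewrite mxE.
exact: sA.
Qed.

Lemma smooth_mxV n (A : V -> 'M[R]_n) : (forall x, U x -> A x \in unitmx) ->
  smooth_mx U A -> smooth_mx U (fun y => invmx (A y)).
Proof. by move=> uA sA i j; exact: Cinfty_invmx. Qed.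

(** Differentiability of the inverse is known from Cramer's rule; its derivative is then read off
    from that of [A *m A^-1 = 1]. *)
Lemma is_dmV n k (A : V -> 'M[R]_n) x A' : (forall x, U x -> A x \in unitmx) ->
  smooth_mx U A -> U x -> is_dm k A x A' ->
  is_dm k (fun y => invmx (A y)) x (- (invmx (A x) *m A' *m invmx (A x))).
Proof.
move=> uA sA Ux dA; have := smooth_is_dm (k := k) (smooth_mxV uA sA) Ux.
set B := dm _ _ _ => dB.
have dAB := is_dmM dA dB.
have d1 : is_dm k (fun y => A y *m invmx (A y)) x 0.
  apply: is_dm_eq (is_dm_cst k 1%:M x) => // y; rewrite inE => Uy.
  by rewrite mulmxV ?uA.
have := is_dm_unique (rel_open_sub oU Ux) dAB d1.
move/eqP; rewrite addrC addr_eq0 => /eqP EB.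
suff -> : - (invmx (A x) *m A' *m invmx (A x)) = B by [].
by rewrite -mulmxA -mulmxN -EB mulKmx ?uA.
Qed.

End On_open.
End Matrix_derivative.

Section Local_geometry.
Variables (R : realType) (d : nat).
Local Notation V := 'rV[R]_d.+1.
Implicit Types (x y : V) (i j k : 'I_d.+1).

Definition differential (f : V -> R) x : V := \row_i pd i f x.

(** [conn G k x] has entry [(i, a)] equal to the Christoffel symbol with upper
    index [a] and lower indices [k] and [i], so that a vector field [X] has
    covariant derivative [d_k X + X *m conn G k x]. *)
Definition conn (G : V -> 'M[R]_d.+1) k x : 'M[R]_d.+1 :=
  \matrix_(i, a) christoffel G a k i x.

(** The Christoffel symbols of the first kind: the upper index [b] is lowered. *)
Definition conn_lower (G : V -> 'M[R]_d.+1) k x : 'M[R]_d.+1 :=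
  \matrix_(i, b) (2^-1 * (pd k (fun y => G y i b) x + pd i (fun y => G y k b) x
     - pd b (fun y => G y k i) x)).

Variables (U : set V) (G : V -> 'M[R]_d.+1).
Hypothesis oU : rel_open U.
Hypothesis sG : smooth_mx U G.
Hypothesis symG : forall x, U x -> (G x)^T = G x.
Hypothesis posG : forall x, U x -> forall w : V, w != 0 -> 0 < inner (G x) w w.

Local Notation Gi := (fun x => invmx (G x)).

Lemma metric_unit x : U x -> G x \in unitmx.
Proof. by move=> Ux; apply: posdef_unit; exact: posG. Qed.

Lemma inverse_metric_sym x : U x -> (Gi x)^T = Gi x.
Proof. by move=> Ux; rewrite trmx_inv symG. Qed.

Lemma pd_metric_sym x i j k : U x ->
  pd k (fun y => G y i j) x = pd k (fun y => G y j i) x.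
Proof.
move=> Ux; apply: (pd_in_eq oU) => [y|y Uy|]; rewrite ?inE//.
  by move=> Uy; rewrite -[in LHS]symG// mxE.
by apply: Cinfty_is_pd.
Qed.

Lemma connE k x : U x -> conn G k x = conn_lower G k x *m Gi x.
Proof.
move=> Ux; apply/matrixP => i a; rewrite !mxE /christoffel mulr_sumr.
apply: eq_bigr => b _; rewrite !mxE -[in LHS](inverse_metric_sym Ux) mxE.
by ring.
Qed.

Lemma conn_lowerE k x : U x -> conn G k x *m G x = conn_lower G k x.
Proof. by move=> Ux; rewrite connE// mulmxKV// metric_unit. Qed.

Lemma conn_lower_sym i j b x : U x -> conn_lower G i x j b = conn_lower G j x i b.
Proof.
move=> Ux; rewrite !mxE [pd b _ _]pd_metric_sym//.
by rewrite [in LHS]addrAC addrAC [X in X - _]addrC.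
Qed.

Lemma conn_sym i j a x : U x -> conn G i x j a = conn G j x i a.
Proof.
move=> Ux; rewrite !connE// !mxE; apply: eq_bigr => b _.
by rewrite conn_lower_sym.
Qed.

(** Compatibility of the connection with the metric. All derivatives of [G] are expressed by it from
    here on. *)
Lemma is_dm_metric k x : U x ->
  is_dm k G x (conn G k x *m G x + G x *m (conn G k x)^T).
Proof.
move=> Ux i j.
have -> : G x *m (conn G k x)^T = (conn_lower G k x)^T.
  by rewrite -conn_lowerE// trmx_mul symG.
rewrite conn_lowerE// !mxE [pd k (fun y => G y j i) x]pd_metric_sym//.
rewrite [_ + _](_ : _ = pd k (fun y => G y i j) x); last by field.
exact: Cinfty_is_pd.
Qed.

End Local_geometry.

(** * Covariant derivatives, the Ricci identity and Bochner's formula *)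

Section Bochner.
Variables (R : realType) (d : nat).
Local Notation V := 'rV[R]_d.+1.
Implicit Types (x y : V) (i j k : 'I_d.+1).
Variables (U : set V) (G : V -> 'M[R]_d.+1).
Hypothesis oU : rel_open U.
Hypothesis sG : smooth_mx U G.
Hypothesis symG : forall x, U x -> (G x)^T = G x.
Hypothesis posG : forall x, U x -> forall w : V, w != 0 -> 0 < inner (G x) w w.

Local Notation Gi := (fun x => invmx (G x)).

Lemma smooth_inverse_metric : smooth_mx U Gi.
Proof. by apply: smooth_mxV => // x Ux; exact: (metric_unit posG). Qed.

Lemma smooth_conn k : smooth_mx U (conn G k).
Proof.
move=> i a; under [X in Cinfty _ X]eq_fun do rewrite mxE.
apply: CinftyM => //; first exact: Cinfty_cst.
apply: Cinfty_sum => // b; apply: CinftyM => //.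
  exact: smooth_inverse_metric.
apply: CinftyD => //; first by apply: CinftyD => //; exact: Cinfty_pd.
by apply: CinftyN => //; exact: Cinfty_pd.
Qed.

Lemma smooth_differential f : Cinfty U f -> smooth_mx U (differential f).
Proof.
move=> sf i j; under [X in Cinfty _ X]eq_fun do rewrite mxE.
exact: Cinfty_pd.
Qed.

Lemma is_dm_inverse_metric k x : U x ->
  is_dm k Gi x (- (Gi x *m conn G k x + (conn G k x)^T *m Gi x)).
Proof.
move=> Ux; have uG := metric_unit posG.
have := is_dmV oU uG sG Ux (is_dm_metric oU sG symG posG (k := k) Ux).
by rewrite mulmxDr mulmxDl !mulmxA mulmxK ?uG// mulVmx ?uG// mul1mx.
Qed.

(** The covariant derivative of a covector field [w], the first index being the direction of
    differentiation. *)
Definition cov_covector (w : V -> V) x : 'M[R]_d.+1 :=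
  \matrix_(k, j) (dm k w x - w x *m (conn G k x)^T) 0 j.

Lemma row_cov_covector w k x :
  row k (cov_covector w x) = dm k w x - w x *m (conn G k x)^T.
Proof. by apply/rowP => j; rewrite !mxE. Qed.

Lemma is_dm_covector w k x : smooth_mx U w -> U x ->
  is_dm k w x (row k (cov_covector w x) + w x *m (conn G k x)^T).
Proof. by move=> sw Ux; rewrite row_cov_covector subrK; exact: smooth_is_dm. Qed.

(** As the metric is parallel, raising an index commutes with covariant differentiation. The
    connection term changes sign and transposition between covectors and vectors. *)
Lemma is_dm_raise w k x : smooth_mx U w -> U x ->
  is_dm k (fun y => w y *m Gi y) x
    (row k (cov_covector w x *m Gi x) - (w x *m Gi x) *m conn G k x).
Proof.
move=> sw Ux; have := is_dmM (is_dm_covector (k := k) sw Ux)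
  (is_dm_inverse_metric (k := k) Ux).
by rewrite mulmxDl mulmxN mulmxDr !mulmxA opprD addrACA subrr addr0 row_mul.
Qed.

(** The connection terms of a covector and of a vector cancel in their pairing, so scalars are
    differentiated below without any Christoffel symbol appearing. *)
Lemma is_pd_pairing k x (w X : V -> V) (A B : V) :
  is_dm k w x (A + w x *m (conn G k x)^T) ->
  is_dm k X x (B - X x *m conn G k x) ->
  is_pd k (fun y => (w y *m (X y)^T) 0 0) x ((A *m (X x)^T + w x *m B^T) 0 0).
Proof.
move=> dw dX; move: (is_dmM dw (is_dm_tr dX)) => /(_ 0 0).
rewrite linearB /= trmx_mul mulmxDl mulmxBr mulmxA.
by rewrite addrACA subrr addr0.
Qed.

Lemma hessE f x : hess G f x = cov_covector (differential f) x.
Proof.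
apply/matrixP => i j; rewrite !mxE; congr (_ - _).
  by congr (pd i _ x); apply/funext => y; rewrite mxE.
by apply: eq_bigr => a _; rewrite !mxE mulrC.
Qed.

Lemma hess_sym f x : Cinfty U f -> U x -> (hess G f x)^T = hess G f x.
Proof.
move=> sf Ux; apply/matrixP => i j; rewrite !mxE (clairaut oU j i (sf 2%N) Ux).
congr (_ - _); apply: eq_bigr => a _; congr (_ * _).
by have := conn_sym oU sG symG j i a Ux; rewrite !mxE.
Qed.

Lemma smooth_cov_covector w : smooth_mx U w -> smooth_mx U (cov_covector w).
Proof.
move=> sw k j; under [X in Cinfty _ X]eq_fun do rewrite !mxE.
apply: CinftyD => //; first by apply: Cinfty_pd.
apply: CinftyN => //; apply: Cinfty_sum => // a.
apply: CinftyM => //; under [X in Cinfty _ X]eq_fun do rewrite mxE.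
exact: smooth_conn.
Qed.

Variable f : V -> R.
Hypothesis sf : Cinfty U f.

Lemma smooth_hess : smooth_mx U (hess G f).
Proof.
have -> : hess G f = cov_covector (differential f).
  by apply/funext => y; exact: hessE.
by apply: smooth_cov_covector; exact: smooth_differential.
Qed.

Lemma smooth_grad : smooth_mx U (grad G f).
Proof.
by apply: smooth_mxM => //; [exact: smooth_differential|exact: smooth_inverse_metric].
Qed.

(** The Hessian as an endomorphism of row vectors: [w *m hess_op x] is the covariant derivative of
    the gradient along [w], and the trace is the Laplacian of [f]. *)
Definition hess_op x : 'M[R]_d.+1 := hess G f x *m invmx (G x).

Lemma smooth_hess_op : smooth_mx U hess_op.
Proof.
by apply: smooth_mxM => //; [exact: smooth_hess|exact: smooth_inverse_metric].
Qed.

Lemma is_dm_grad k x : U x ->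
  is_dm k (grad G f) x (row k (hess_op x) - grad G f x *m conn G k x).
Proof.
by move=> Ux; rewrite /hess_op hessE; apply: is_dm_raise => //;
  exact: smooth_differential.
Qed.

(** The contracted Ricci identity for the gradient: the divergence of [hess_op] is the differential
    of its trace plus a Ricci term. On [U] the row [l] of [hess_op] is [d_l D + D *m conn G l], so
    the second derivatives of [D] cancel by [clairaut] and commutators of connection matrices
    remain. *)
Lemma ricci_identity c x : U x ->
  \sum_k (dm k hess_op x - conn G k x *m hess_op x + hess_op x *m conn G k x) c k =
  \sum_k dm c hess_op x k k + \sum_b ricci G x c b * grad G f x 0 b.
Proof.
move=> Ux; set D := grad G f x; set S := hess_op x.
have dS k l m : dm k hess_op x l m = pd k (pd l (fun y => grad G f y 0 m)) x
   + ((row k S - D *m conn G k x) *m conn G l x + D *m dm k (conn G l) x) 0 m.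
  rewrite mxE; apply: is_pdP; first exact: (rel_open_sub oU).
  apply: (@is_pd_eq _ _ _ _ (fun y => pd l (fun y => grad G f y 0 m) y +
     (grad G f y *m conn G l y) 0 m) _ _ _ oU Ux).
    move=> y; rewrite inE => Uy.
    have /(_ 0 m) dD := is_dm_grad (k := l) Uy.
    rewrite (is_pdP (rel_open_sub oU Uy) dD).
    by rewrite !mxE subrK.
  apply: is_pdD.
    by apply: Cinfty_is_pd Ux; apply: Cinfty_pd; exact: smooth_grad.
  apply: (is_dmM (is_dm_grad (k := k) Ux)).
  exact: smooth_is_dm (@smooth_conn l) Ux.
have E1 : \sum_k dm k hess_op x c k = \sum_k dm c hess_op x k k +
   \sum_k (((row k S - D *m conn G k x) *m conn G c x + D *m dm k (conn G c) x) 0 k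
    - ((row c S - D *m conn G c x) *m conn G k x + D *m dm c (conn G k) x) 0 k).
  rewrite -big_split; apply: eq_bigr => k _ /=; rewrite !dS.
  rewrite (clairaut oU c k (smooth_grad 0 k 2%N) Ux).
  by rewrite -addrA; congr (_ + _); rewrite addrC subrK.
have mxABC (A B C : 'M[R]_d.+1) i j :
  (A - B + C) i j = A i j + (C i j - B i j) by rewrite !mxE; ring.
under eq_bigr do rewrite mxABC.
rewrite big_split /= E1 -addrA; congr (_ + _); rewrite -big_split /=.
(* The first-order terms in [D] cancel because the Christoffel symbols are symmetric in their lower
   indices. *)
have E2 : \sum_k (conn G k x *m S) c k = \sum_k (row k S *m conn G c x) 0 k.
  under eq_bigr do rewrite mxE; under [RHS]eq_bigr do rewrite mxE.
  rewrite exchange_big; apply: eq_bigr => k _; apply: eq_bigr => e _.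
  by rewrite (conn_sym oU sG symG e c k Ux) [row k S 0 e]mxE mulrC.
(* The Ricci tensor as a contraction of the curvature matrices, that is, of the commutators of
   covariant derivatives. *)
have E3 : \sum_b ricci G x c b * D 0 b = \sum_k (D *m (conn G c x *m conn G k x
    - conn G k x *m conn G c x + dm k (conn G c) x - dm c (conn G k) x)) 0 k.
  under [RHS]eq_bigr do rewrite mxE.
  rewrite exchange_big; apply: eq_bigr => b _ /=.
  rewrite mulrC -mulr_sumr; congr (_ * _); rewrite !mxE.
  apply: eq_bigr => k _; rewrite !mxE.
  have -> : pd k (fun y => conn G c y b k) x = pd k (christoffel G k c b) x.
    by congr (pd k _ x); apply/funext => y; rewrite mxE.
  have -> : pd c (fun y => conn G k y b k) x = pd c (christoffel G k k b) x.
    by congr (pd c _ x); apply/funext => y; rewrite mxE.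
  have -> : \sum_e (christoffel G k k e x * christoffel G e c b x -
      christoffel G k c e x * christoffel G e k b x) =
      \sum_e conn G c x b e * conn G k x e k
      - \sum_e conn G k x b e * conn G c x e k.
    by rewrite -sumrB; apply: eq_bigr => e _; rewrite !mxE; ring.
  by rewrite [LHS]addrC [LHS]addrA.
rewrite E3.
transitivity (\sum_k ((row k S *m conn G c x) 0 k - (conn G k x *m S) c k
   + (D *m (conn G c x *m conn G k x
    - conn G k x *m conn G c x + dm k (conn G c) x - dm c (conn G k) x)) 0 k)).
  apply: eq_bigr => k _.
  have -> : (S *m conn G k x) c k = (row c S *m conn G k x) 0 k.
    by rewrite -row_mul [RHS]mxE.
  have mxE6 (a1 a2 a3 a4 a5 a6 : V) (r : R) :
    (a1 - a2 + a3) 0 k - (a4 - a5 + a6) 0 k + (a4 0 k - r) =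
    a1 0 k - r + (a5 - a2 + a3 - a6) 0 k by rewrite !mxE; ring.
  by rewrite !(mulmxBl, mulmxDr, mulmxN) !mulmxA mxE6.
by rewrite big_split/= sumrB E2 subrr add0r.
Qed.

Definition grad_hess x : V := grad G f x *m hess G f x.

Lemma smooth_grad_hess : smooth_mx U grad_hess.
Proof. by apply: smooth_mxM => //; [exact: smooth_grad|exact: smooth_hess]. Qed.

(** Here [grad_hess] is the differential of [|grad f|^2 / 2]. *)
Lemma bochner x : U x ->
  \tr (cov_covector grad_hess x *m invmx (G x)) =
  \sum_k grad G f x 0 k * pd k (fun y => \tr (hess_op y)) x
  + inner (ricci G x) (grad G f x) (grad G f x) + \tr (hess_op x *m hess_op x).
Proof.
move=> Ux; set D := grad G f x; set S := hess_op x.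
(* The vector field [grad_hess *m Gi] equals [D *m S]. Its derivative is computed once as that of a
   raised covector and once by the product rule. *)
have key k : row k (cov_covector grad_hess x *m invmx (G x)) =
   row k (S *m S) + D *m (dm k hess_op x - conn G k x *m S + S *m conn G k x).
  have d1 := is_dm_raise (k := k) smooth_grad_hess Ux.
  have d2 := is_dmM (is_dm_grad (k := k) Ux) (smooth_is_dm (k := k) smooth_hess_op Ux).
  have : is_dm k (fun y => grad_hess y *m Gi y) x
      ((row k S - D *m conn G k x) *m S + D *m dm k hess_op x).
    under [X in is_dm _ X]eq_fun do rewrite /grad_hess -mulmxA.
    exact: d2.
  move/(is_dm_unique (rel_open_sub oU Ux) d1)/eqP; rewrite subr_eq => /eqP ->.
  rewrite /grad_hess -/D -[D *m _ *m invmx _]mulmxA -/(hess_op x) -/S.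
  rewrite row_mul mulmxBl !(mulmxDr, mulmxN) !mulmxA !addrA.
  by congr (_ + _); rewrite addrAC.
have -> : \tr (cov_covector grad_hess x *m invmx (G x)) =
  \tr (S *m S) + \sum_k (D *m (dm k hess_op x - conn G k x *m S + S *m conn G k x)) 0 k.
  rewrite -big_split; apply: eq_bigr => k _ /=.
  transitivity (row k (cov_covector grad_hess x *m invmx (G x)) 0 k).
    by rewrite [RHS]mxE.
  by rewrite key [LHS]mxE; congr (_ + _); rewrite [LHS]mxE.
rewrite [RHS]addrC; congr (_ + _).
under eq_bigr do rewrite mxE.
rewrite exchange_big /=.
under eq_bigr => c _ do rewrite -mulr_sumr (ricci_identity c Ux) mulrDr.
rewrite big_split /=; congr (_ + _).
  apply: eq_bigr => c _; congr (_ * _); apply/esym/is_pdP.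
    exact: (rel_open_sub oU).
  exact: (is_pd_trace (smooth_is_dm (k := c) smooth_hess_op Ux)).
rewrite innerE; apply: eq_bigr => c _; rewrite mulr_sumr.
by apply: eq_bigr => b _; rewrite mulrA.
Qed.

End Bochner.

(** * The metric induced on a graph *)

Section Row_vectors.
Variables (R : realType) (n : nat).
Implicit Types (u w : 'rV[R]_n) (A : 'M[R]_n).

Lemma dot_sym u w : (u *m w^T) 0 0 = (w *m u^T) 0 0.
Proof. by rewrite !mxE; apply: eq_bigr => k _; rewrite !mxE mulrC. Qed.

Lemma dot_row u w A :
  (u *m A *m w^T) 0 0 = \sum_k u 0 k * (row k A *m w^T) 0 0.
Proof.
by rewrite -mulmxA mxE; apply: eq_bigr => k _; rewrite -row_mul [in RHS]mxE.
Qed.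

Lemma mxtrace_outer u w A : \tr (A *m (u^T *m w)) = (w *m A *m u^T) 0 0.
Proof. by rewrite mulmxA mxtrace_mulC mulmxA trace_mx11. Qed.

Lemma dot_tr u w A : A^T = A -> (u *m A *m w^T) 0 0 = (w *m A *m u^T) 0 0.
Proof. exact: inner_sym. Qed.

End Row_vectors.

Lemma laplacianE (R : realType) (d : nat) (A : 'rV[R]_d.+1 -> 'M[R]_d.+1) u x :
  (invmx (A x))^T = invmx (A x) ->
  laplacian A u x = \tr (hess A u x *m invmx (A x)).
Proof.
move=> sA; apply: eq_bigr => i _ /=; rewrite [RHS]mxE.
by apply: eq_bigr => j _; rewrite mulrC -[in LHS]sA [X in _ * X]mxE.
Qed.

Lemma is_pdN (R : realType) (d : nat) i (f : 'rV[R]_d.+1 -> R) x a :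
  is_pd i f x a -> is_pd i (fun y => - f y) x (- a).
Proof.
move=> fa; have := is_pdM (is_pd_cst i x (-1)) fa.
rewrite mul0r add0r mulN1r.
move=> fN; rewrite [X in is_pd _ X](_ : _ = fun y => -1 * f y)//.
by apply/funext => y; rewrite mulN1r.
Qed.

Section Graph_metric.
Variables (R : realType) (d : nat).
Local Notation V := 'rV[R]_d.+1.
Implicit Types (x y : V) (i j k : 'I_d.+1).
Variables (U : set V) (G : V -> 'M[R]_d.+1).
Hypothesis oU : rel_open U.
Hypothesis sG : smooth_mx U G.
Hypothesis symG : forall x, U x -> (G x)^T = G x.
Hypothesis posG : forall x, U x -> forall w : V, w != 0 -> 0 < inner (G x) w w.

Local Notation Gi := (fun x => invmx (G x)).

Lemma inner_raise (w w' : V) x : U x ->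
  inner (G x) (w *m Gi x) (w' *m Gi x) = (w *m Gi x *m w'^T) 0 0.
Proof.
move=> Ux; rewrite /inner trmx_mul (inverse_metric_sym symG Ux) -mulmxA.
by rewrite mulKVmx ?(metric_unit posG)// !mulmxA.
Qed.

Lemma inner_ge0 x (w : V) : U x -> 0 <= inner (G x) w w.
Proof.
move=> Ux; have [->|w0] := eqVneq w 0; last by rewrite ltW// posG.
by rewrite /inner !mul0mx mxE.
Qed.

Variable f : V -> R.
Hypothesis sf : Cinfty U f.

Local Notation p := (differential f).
Local Notation D := (grad G f).
Local Notation F := (hess G f).
Local Notation S := (hess_op G f).
Local Notation b := (grad_hess G f).

Definition area x : R := Num.sqrt (1 + inner (G x) (D x) (D x)).
Local Notation W := area.

(** The height component [<N, d/dt>] of the downward normal [N] of the graph. *)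
Definition angle x : R := - (W x)^-1.

Definition hess_grad_grad x : R := (b x *m (D x)^T) 0 0.
Definition graph_metric x : 'M[R]_d.+1 := G x + (p x)^T *m p x.
Local Notation gt := graph_metric.

Lemma gradE g x : grad G g x = differential g x *m invmx (G x).
Proof. by []. Qed.

Lemma grad_metric x : U x -> D x *m G x = p x.
Proof. by move=> Ux; rewrite gradE mulmxKV// (metric_unit posG). Qed.

Lemma metric_grad x : U x -> G x *m (D x)^T = (p x)^T.
Proof. by move=> Ux; rewrite -(grad_metric Ux) [in RHS]trmx_mul symG. Qed.

Lemma inner_grad x : U x -> inner (G x) (D x) (D x) = (p x *m (D x)^T) 0 0.
Proof. by move=> Ux; rewrite /inner grad_metric. Qed.

Lemma area_gt0 x : U x -> 0 < W x.
Proof. by move=> Ux; rewrite sqrtr_gt0 ltr_pwDl// inner_ge0. Qed.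

Lemma area_sqr x : U x -> W x * W x = 1 + (p x *m (D x)^T) 0 0.
Proof.
move=> Ux; rewrite -expr2 sqr_sqrtr ?inner_grad//.
by rewrite -inner_grad// addr_ge0 ?inner_ge0.
Qed.

Lemma area_neq0 x : U x -> W x != 0.
Proof. by move=> Ux; rewrite gt_eqF ?area_gt0. Qed.

Lemma tr_grad_hess x : U x -> (b x)^T = F x *m (D x)^T.
Proof. by move=> Ux; rewrite trmx_mul (hess_sym oU sG symG sf Ux). Qed.

Lemma raise_grad_hess x : b x *m Gi x = D x *m S x.
Proof. by rewrite -mulmxA. Qed.

Lemma row_hess_dot k x (w : V) : (row k (F x) *m w^T) 0 0 = (F x *m w^T) k 0.
Proof. by rewrite -row_mul mxE. Qed.

Lemma is_pd_inner_grad k x : U x ->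
  is_pd k (fun y => 1 + inner (G y) (D y) (D y)) x (2 * b x 0 k).
Proof.
move=> Ux.
have dp := is_dm_covector (G := G) (k := k) (smooth_differential sf) Ux.
have := is_pd_pairing dp (is_dm_grad oU sG symG posG sf (k := k) Ux).
have Eb : b x 0 k = (row k (F x) *m (D x)^T) 0 0.
  by rewrite row_hess_dot -tr_grad_hess// [RHS]mxE.
rewrite -hessE.
have -> : (row k (F x) *m (D x)^T + p x *m (row k (S x))^T) 0 0 = 2 * b x 0 k.
  rewrite mxE mulr_natl mulr2n {1}Eb; congr (_ + _).
  rewrite /hess_op row_mul trmx_mul (inverse_metric_sym symG Ux) mulmxA.
  by rewrite -gradE dot_sym Eb.
move=> dq; have := is_pdD (is_pd_cst k x 1) dq; rewrite add0r.
apply: (is_pd_eq oU Ux) => y; rewrite inE => Uy.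
by rewrite inner_grad.
Qed.

Lemma is_pd_area k x : U x -> is_pd k W x (b x 0 k / W x).
Proof.
move=> Ux; have := is_pd_sqrt _ (is_pd_inner_grad (k := k) Ux).
rewrite -sqrtr_gt0 => /(_ (area_gt0 Ux)).
suff -> : 2 * b x 0 k / (2 * W x) = b x 0 k / W x by [].
by rewrite -mulf_div divff ?mul1r// pnatr_eq0.
Qed.

Lemma is_pd_invarea k x : U x ->
  is_pd k (fun y => (W y)^-1) x (- b x 0 k * (W x)^-1 ^+ 3).
Proof.
move=> Ux; have := is_pdV (area_neq0 Ux) (is_pd_area (k := k) Ux).
by rewrite exprS expr2 !mulNr !mulrA.
Qed.

Lemma is_pd_angle k x : U x -> is_pd k angle x (b x 0 k * (W x)^-1 ^+ 3).
Proof.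
by move=> Ux; have := is_pdN (is_pd_invarea (k := k) Ux); rewrite mulNr opprK.
Qed.

Lemma smooth_area : Cinfty U W.
Proof.
apply: Cinfty_sqrt => // [x Ux|]; first by rewrite ltr_pwDl// inner_ge0.
apply: CinftyD => //; first exact: Cinfty_cst.
apply: (@Cinfty_eq _ _ _ oU (fun x => (p x *m (D x)^T) 0 0)) => [x|].
  by rewrite inE => Ux; rewrite inner_grad.
apply: smooth_mxM => //; first exact: smooth_differential.
by apply: smooth_mx_tr; exact: (smooth_grad oU sG posG sf).
Qed.

Lemma smooth_angle : Cinfty U angle.
Proof.
apply: CinftyN => //; apply: CinftyV => //; first exact: area_neq0.
exact: smooth_area.
Qed.

Lemma differential_angle x : U x ->
  differential angle x = (W x)^-1 ^+ 3 *: b x.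
Proof.
move=> Ux; apply/rowP => k; rewrite !mxE mulrC.
have /is_pdP -> := is_pd_angle (k := k) Ux; first by rewrite mxE.
exact: (rel_open_sub oU).
Qed.

Lemma graph_metric_smooth : smooth_mx U gt.
Proof.
move=> i j; under [X in Cinfty _ X]eq_fun do rewrite mxE.
apply: CinftyD => //.
by apply: smooth_mxM => //; [apply: smooth_mx_tr|]; exact: smooth_differential.
Qed.

Lemma graph_metric_sym x : U x -> (gt x)^T = gt x.
Proof. by move=> Ux; rewrite linearD /= trmx_mul trmxK symG. Qed.

Lemma graph_metric_pos x : U x ->
  forall w : V, w != 0 -> 0 < inner (gt x) w w.
Proof.
move=> Ux w w0; rewrite /inner mulmxDr mulmxDl mxE ltr_pwDl//; first exact: posG.
rewrite mulmxA -mulmxA -{1}[w *m _]trmxK trmx_mul trmxK.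
by rewrite mxE big_ord1 !mxE -expr2 sqr_ge0.
Qed.

(** Both sides are compared after lowering the index with the graph metric. The perturbation
    [df^T df] adds [(d_k d_i f) * d_b f] to the symbols of the first kind, and [D] is lowered to
    [W ^+ 2] times [df]. *)
Lemma conn_graph_metric k x : U x ->
  conn gt k x = conn G k x + ((W x)^-1 ^+ 2) *: ((row k (F x))^T *m D x).
Proof.
move=> Ux; have ug := metric_unit graph_metric_pos Ux.
apply: (can_inj (mulmxK ug)).
rewrite (conn_lowerE graph_metric_sym graph_metric_pos)//.
have -> : conn_lower gt k x = conn_lower G k x + (dm k p x)^T *m p x.
  have dg i j l : pd l (fun y => gt y i j) x = pd l (fun y => G y i j) x +
     (pd l (pd i f) x * p x 0 j + p x 0 i * pd l (pd j f) x).
    apply: is_pdP; first exact: (rel_open_sub oU).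
    under [X in is_pd _ X]eq_fun do rewrite mxE.
    apply: is_pdD; first exact: Cinfty_is_pd.
    under [X in is_pd _ X]eq_fun do rewrite mxE big_ord1 !mxE.
    rewrite !mxE; by apply: is_pdM; apply: (Cinfty_is_pd _ Ux); exact: Cinfty_pd.
  have C i j := clairaut oU i j (sf 2%N) Ux.
  apply/matrixP => i j; rewrite !mxE !dg big_ord1 !mxE.
  rewrite (C i k) (C j k) (C j i).
  have -> : pd k (fun y => p y 0 i) x = pd k (pd i f) x.
    by congr (pd k _ x); apply/funext => y; rewrite mxE.
  move: (pd k (pd i f) x) (pd k (pd j f) x) (pd i (pd j f) x) => a1 a2 a3.
  move: (pd k (fun y => G y i j) x) (pd i (fun y => G y k j) x) => a4 a5.
  move: (pd j (fun y => G y k i) x) (pd i f x) (pd j f x) (pd k f x) => a6 a7 a8 a9.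
  by field.
have DP : D x *m (p x)^T = (W x ^+ 2 - 1)%:M.
  by rewrite [LHS]mx11_scalar dot_sym expr2 area_sqr// addrC addKr.
have cp : (dm k p x)^T = (row k (F x))^T + conn G k x *m (p x)^T.
  by rewrite hessE row_cov_covector linearB /= trmx_mul trmxK subrK.
have W0 := area_neq0 Ux.
rewrite cp /graph_metric [in RHS]mulmxDl !(mulmxDr (conn G k x)).
rewrite (conn_lowerE symG posG)// -addrA; congr (_ + _).
move: DP (grad_metric Ux); move: (D x) => Dx DP DG.
rewrite -scalemxAl mulmxDr -!mulmxA DG (mulmxA Dx) DP.
rewrite mul_scalar_mx -scalemxAr -[X in _ *: (X + _)]scale1r -scalerDl scalerA.
rewrite [1 + _]addrC subrK exprVn mulVf ?expf_neq0// scale1r.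
by rewrite mulmxDl addrC mulmxA.
Qed.

End Graph_metric.

(** * Hessian and Laplacian of the graph metric *)

Section Graph_laplacian.
Variables (R : realType) (d : nat).
Local Notation V := 'rV[R]_d.+1.
Implicit Types (x y : V) (i j k : 'I_d.+1).
Variables (U : set V) (G : V -> 'M[R]_d.+1).
Hypothesis oU : rel_open U.
Hypothesis sG : smooth_mx U G.
Hypothesis symG : forall x, U x -> (G x)^T = G x.
Hypothesis posG : forall x, U x -> forall w : V, w != 0 -> 0 < inner (G x) w w.
Variable f : V -> R.
Hypothesis sf : Cinfty U f.

Local Notation Gi := (fun x => invmx (G x)).
Local Notation p := (differential f).
Local Notation D := (grad G f).
Local Notation F := (hess G f).
Local Notation S := (hess_op G f).
Local Notation b := (grad_hess G f).
Local Notation W := (area G f).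
Local Notation beta := (hess_grad_grad G f).
Local Notation gt := (graph_metric G f).
Local Notation Hb := (cov_covector G b).

Lemma hess_graph_metric g x : U x ->
  hess gt g x =
  hess G g x - ((W x)^-1 ^+ 2 * (D x *m (differential g x)^T) 0 0) *: F x.
Proof.
move=> Ux; have C i j a : christoffel gt a i j x =
    christoffel G a i j x + (W x)^-1 ^+ 2 * (F x i j * D x 0 a).
  have := conn_graph_metric oU sG symG posG sf i Ux.
  move=> /matrixP/(_ j a); rewrite mxE => ->.
  by rewrite !mxE big_ord1 !mxE.
apply/matrixP => i j; rewrite [LHS]mxE [RHS]mxE [hess G g x i j]mxE.
rewrite [X in _ = _ + X]mxE [X in _ = _ - X]mxE -addrA -opprD.
congr (_ - _); rewrite [(D x *m _) 0 0]mxE mulr_sumr mulr_suml -big_split.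
apply: eq_bigr => a _ /=; rewrite C.
have -> : (differential g x)^T a 0 = pd a g x by rewrite !mxE.
by move: (christoffel G a i j x) (F x i j) => c1 c2; ring.
Qed.

(** The Sherman-Morrison formula for a rank-one perturbation, with denominator
    [1 + p *m D^T = W ^+ 2]. *)
Lemma graph_metricV x : U x ->
  invmx (gt x) = Gi x - (W x)^-1 ^+ 2 *: ((D x)^T *m D x).
Proof.
move=> Ux; have ug := metric_unit (graph_metric_pos posG f) Ux.
have W0 := area_neq0 posG f Ux.
apply: (can_inj (mulKmx ug)); rewrite mulmxV//.
have DP : p x *m (D x)^T = (W x ^+ 2 - 1)%:M.
  by rewrite [LHS]mx11_scalar expr2 (area_sqr posG)// addrC addKr.
have ND : gt x *m (D x)^T = W x ^+ 2 *: (p x)^T.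
  rewrite mulmxDl (metric_grad symG posG f Ux) -mulmxA DP mul_mx_scalar.
  by rewrite -[X in X + _]scale1r -scalerDl addrC subrK.
rewrite mulmxBr -scalemxAr mulmxA ND -scalemxAl scalerA exprVn.
rewrite mulVf ?expf_neq0// scale1r mulmxDl mulmxV ?(metric_unit posG)//.
by rewrite -mulmxA addrK.
Qed.

Lemma graph_metricV_sym x : U x -> (invmx (gt x))^T = invmx (gt x).
Proof. by move=> Ux; rewrite trmx_inv (graph_metric_sym symG f). Qed.

(** The differential of the angle is [W^-3 b]. Its covariant derivative for [G] gives the first two
    terms; the last one is the change of connection, in which [D] is contracted with [W^-3 b]. *)
Lemma hess_graph_angle x : U x ->
  hess gt (angle G f) x = (W x)^-1 ^+ 3 *: Hb x
    - (3 * (W x)^-1 ^+ 5) *: ((b x)^T *m b x)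
    - ((W x)^-1 ^+ 5 * beta x) *: F x.
Proof.
move=> Ux; rewrite hess_graph_metric//.
rewrite (differential_angle oU sG symG posG sf Ux).
have -> : (W x)^-1 ^+ 2 * (D x *m ((W x)^-1 ^+ 3 *: b x)^T) 0 0 =
    (W x)^-1 ^+ 5 * beta x.
  by rewrite linearZ /= -scalemxAr mxE dot_sym -/(beta x) mulrA -exprD.
congr (_ - _); apply/matrixP => i j.
have du k y : U y -> pd k (angle G f) y = b y 0 k * (W y)^-1 ^+ 3.
  move=> Uy; apply: is_pdP; first exact: (rel_open_sub oU).
  exact: (is_pd_angle oU sG symG posG sf).
have -> : hess G (angle G f) x i j = pd i (pd j (angle G f)) x
    - \sum_a conn G i x j a * pd a (angle G f) x.
  by rewrite mxE; congr (_ - _); apply: eq_bigr => a _; rewrite mxE.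
have -> : pd i (pd j (angle G f)) x = (dm i b x 0 j) * (W x)^-1 ^+ 3
    - 3 * (W x)^-1 ^+ 5 * (b x 0 i * b x 0 j).
  apply: is_pdP; first exact: (rel_open_sub oU).
  apply: (@is_pd_eq _ _ _ _ (fun y => b y 0 j * ((W y)^-1 * ((W y)^-1 * (W y)^-1)))
     _ _ _ oU Ux).
    by move=> y; rewrite inE => Uy; rewrite du// exprS expr2.
  have dW := is_pd_invarea oU sG symG posG sf (k := i) Ux.
  have db := smooth_is_dm (k := i) (smooth_grad_hess oU sG posG sf) Ux.
  have := is_pdM (db 0 j) (is_pdM dW (is_pdM dW dW)).
  set w := (W x)^-1; move: (dm i b x 0 j) (b x 0 i) (b x 0 j) => c1 c2 c3.
  by congr (is_pd _ _ _ _); ring.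
under eq_bigr => a _ do rewrite (du a x Ux).
have HbE : Hb x i j = dm i b x 0 j - \sum_a b x 0 a * conn G i x j a.
  rewrite mxE [LHS]mxE; congr (_ + _); rewrite mxE mxE; congr (- _).
  by apply: eq_bigr => a _; rewrite [(_^T) a j]mxE.
have outer (u w : V) k l : (u^T *m w) k l = u 0 k * w 0 l.
  by rewrite mxE big_ord1 mxE.
have lin (a1 a2 : R) (A B : 'M[R]_d.+1) k l :
  (a1 *: A - a2 *: B) k l = a1 * A k l - a2 * B k l by rewrite !mxE.
rewrite lin outer HbE.
have -> : \sum_a conn G i x j a * (b x 0 a * (W x)^-1 ^+ 3) =
    (\sum_a b x 0 a * conn G i x j a) * (W x)^-1 ^+ 3.
  by rewrite mulr_suml; apply: eq_bigr => a _; rewrite mulrA [_ * b x 0 a]mulrC.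
move: (\sum_a _) (dm i b x 0 j) (b x 0 i) (b x 0 j) (W x)^-1 => c1 c2 c3 c4 c5.
by ring.
Qed.

(** The weighted Laplacian of the angle function, before using the constancy of
    the mean curvature; [g] is the weight restricted to the graph. *)
Lemma weighted_laplacian_angle g x : U x ->
  weighted_laplacian gt g (angle G f) x =
  (W x)^-1 ^+ 3 * (\tr (Hb x *m Gi x)
      - (W x)^-1 ^+ 2 * (D x *m Hb x *m (D x)^T) 0 0)
  - 3 * (W x)^-1 ^+ 5 * ((b x *m Gi x *m (b x)^T) 0 0
      - (W x)^-1 ^+ 2 * beta x ^+ 2)
  - (W x)^-1 ^+ 5 * beta x * (\tr (S x) - (W x)^-1 ^+ 2 * beta x)
  + (W x)^-1 ^+ 3 * ((differential g x *m Gi x *m (b x)^T) 0 0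
      - (W x)^-1 ^+ 2 * (differential g x *m (D x)^T) 0 0 * beta x).
Proof.
move=> Ux; rewrite /weighted_laplacian laplacianE; last exact: graph_metricV_sym.
have trQ A : \tr (A *m invmx (gt x)) =
    \tr (A *m Gi x) - (W x)^-1 ^+ 2 * (D x *m A *m (D x)^T) 0 0.
  by rewrite graph_metricV// mulmxBr raddfB /= -scalemxAr mxtraceZ mxtrace_outer.
have sgt := graph_metric_sym symG f; have pgt := graph_metric_pos posG f.
have gE u : grad gt u x = differential u x *m invmx (gt x) by [].
rewrite !gE (inner_raise sgt pgt)// (differential_angle oU sG symG posG sf Ux).
rewrite hess_graph_angle// !mulmxBl !raddfB /= -!scalemxAl !mxtraceZ !trQ.
have -> : (D x *m F x *m (D x)^T) 0 0 = beta x by [].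
have -> : \tr (F x *m Gi x) = \tr (S x) by [].
have -> : \tr ((b x)^T *m b x *m Gi x) = (b x *m Gi x *m (b x)^T) 0 0.
  by rewrite -mulmxA mxtrace_mulC trace_mx11.
have -> : (D x *m ((b x)^T *m b x) *m (D x)^T) 0 0 = beta x ^+ 2.
  rewrite /beta; move: (b x) (D x) => u w.
  rewrite mulmxA -mulmxA [w *m u^T]mx11_scalar mul_scalar_mx mxE.
  by rewrite dot_sym expr2.
have -> : (differential g x *m invmx (gt x) *m ((W x)^-1 ^+ 3 *: b x)^T) 0 0
   = (W x)^-1 ^+ 3 * ((differential g x *m Gi x *m (b x)^T) 0 0
      - (W x)^-1 ^+ 2 * (differential g x *m (D x)^T) 0 0 * beta x).
  rewrite linearZ /= -scalemxAr mxE; congr (_ * _).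
  rewrite graph_metricV// mulmxBr mulmxBl -scalemxAr -scalemxAl /beta.
  move: (differential g x) (b x) (D x) => w' u w.
  rewrite mulmxA -(mulmxA (_ *m w^T)) [X in X *m (w *m _)]mx11_scalar mul_scalar_mx.
  have entry (A B : 'M[R]_1) (a c : R) :
    (A - a *: (c *: B)) 0 0 = A 0 0 - a * c * B 0 0 by rewrite !mxE mulrA.
  by rewrite entry (dot_sym w).
by [].
Qed.

End Graph_laplacian.

(** Distribution of a sum over its summands, stated for arbitrary families so that induction and
    [ring] suffice. *)
Lemma sum_mean_curvature_defect (R : comNzRingType) n
    (D T B1 B2 b H1 H2 p : 'I_n -> R) (w beta v2 H : R) :
  \sum_k D k * (T k - ((B1 k + B2 k) * (w * w)
      + beta * (- b k * w ^+ 3 * w + w * (- b k * w ^+ 3)))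
    + (H1 k + H2 k) - v2 * p k + H * (b k * w)) =
  \sum_k D k * T k - w ^+ 2 * (\sum_k D k * B1 k + \sum_k D k * B2 k)
  + 2 * w ^+ 4 * (beta * \sum_k D k * b k)
  + \sum_k D k * H1 k + \sum_k D k * H2 k - v2 * \sum_k D k * p k
  + H * ((\sum_k D k * b k) * w).
Proof.
elim: n => [|n IH] in D T B1 B2 b H1 H2 p *; first by rewrite !big_ord0; ring.
by rewrite !big_ord_recl IH; ring.
Qed.

(** * Use of the constancy of the mean curvature *)

Section Constant_mean_curvature.
Variables (R : realType) (d : nat).
Local Notation V := 'rV[R]_d.+1.
Implicit Types (x y : V) (i j k : 'I_d.+1).
Variables (U : set V) (G : V -> 'M[R]_d.+1).
Hypothesis oU : rel_open U.
Hypothesis sG : smooth_mx U G.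
Hypothesis symG : forall x, U x -> (G x)^T = G x.
Hypothesis posG : forall x, U x -> forall w : V, w != 0 -> 0 < inner (G x) w w.
Variables (f h : V -> R) (v : R -> R) (H : R).
Hypothesis sf : Cinfty U f.
Hypothesis sh : Cinfty U h.
Hypothesis sv : forall (m : nat) (t : R), derivable (derive1n m v) t 1.

Local Notation Gi := (fun x => invmx (G x)).
Local Notation p := (differential f).
Local Notation D := (grad G f).
Local Notation F := (hess G f).
Local Notation S := (hess_op G f).
Local Notation b := (grad_hess G f).
Local Notation W := (area G f).
Local Notation beta := (hess_grad_grad G f).
Local Notation gt := (graph_metric G f).
Local Notation Hb := (cov_covector G b).

Lemma is_derive_derive1n (m : nat) (t : R) :
  is_derive t 1 (derive1n m v) (derive1n m.+1 v t).
Proof. by apply: DeriveDef => //; rewrite derive1nS derive1E. Qed.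

Lemma is_pd_derive1n_comp m k x : U x ->
  is_pd k (fun y => derive1n m v (f y)) x (derive1n m.+1 v (f x) * pd k f x).
Proof.
move=> Ux; apply: (is_pd_comp (g := derive1n m v)); first exact: Cinfty_is_pd.
exact: is_derive_derive1n.
Qed.

Lemma differential_weight x : U x ->
  differential (fun y => h y + v (f y)) x =
  differential h x + derive1 v (f x) *: p x.
Proof.
move=> Ux; apply/rowP => k; rewrite !mxE; apply: is_pdP.
  exact: (rel_open_sub oU).
apply: is_pdD; first exact: Cinfty_is_pd.
exact: (@is_pd_derive1n_comp 0).
Qed.

(** Equals [W * (H - H_psi)], where [H_psi] is the weighted mean curvature of the
    graph of [f]. *)
Definition mean_curvature_defect y : R :=
  \tr (S y) - beta y * ((W y)^-1 * (W y)^-1)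
  + (differential h y *m (D y)^T) 0 0 - derive1 v (f y) + H * W y.

Hypothesis cH : forall y, U y -> mean_curvature_defect y = 0.

(** The derivative along [D] of the identity [cH]. Its first term is the one that Bochner's formula
    produces, and its other third-order term is the value of [Hb] at [(D, D)]. *)
Lemma grad_mean_curvature_defect x : U x ->
  \sum_k D x 0 k * pd k (fun y => \tr (S y)) x
  - (W x)^-1 ^+ 2 * ((D x *m Hb x *m (D x)^T) 0 0
                    + (b x *m Gi x *m (b x)^T) 0 0)
  + 2 * (W x)^-1 ^+ 4 * beta x ^+ 2
  + inner (hess G h x) (D x) (D x) + (differential h x *m Gi x *m (b x)^T) 0 0
  - derive1n 2 v (f x) * (p x *m (D x)^T) 0 0 + H * (beta x * (W x)^-1) = 0.
Proof.
move=> Ux; have Hx := rel_open_sub oU Ux.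
have dD k := is_dm_grad oU sG symG posG sf (k := k) Ux.
have ek k : pd k (fun y => \tr (S y)) x
    - (((row k (Hb x) *m (D x)^T) 0 0 + (row k (S x) *m (b x)^T) 0 0)
         * ((W x)^-1 * (W x)^-1)
       + beta x * (- b x 0 k * (W x)^-1 ^+ 3 * (W x)^-1
                   + (W x)^-1 * (- b x 0 k * (W x)^-1 ^+ 3)))
    + ((row k (hess G h x) *m (D x)^T) 0 0
       + (row k (S x) *m (differential h x)^T) 0 0)
    - derive1n 2 v (f x) * p x 0 k + H * (b x 0 k / W x) = 0.
  have dE : is_pd k mean_curvature_defect x 0.
    apply: (is_pd_eq oU Ux) (is_pd_cst k x 0) => y; rewrite inE => Uy.
    by rewrite cH.
  rewrite -(is_pdP Hx dE); apply/esym/is_pdP => //.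
  (* Exchanging the factors of the second product brings the derivative into the form of
     [is_pd_pairing]. *)
  have dot_add (A B C E : V) : (A *m B^T) 0 0 + (C *m E^T) 0 0 =
      (A *m B^T + E *m C^T) 0 0 by rewrite [RHS]mxE (dot_sym C).
  have dS := smooth_is_dm (k := k) (smooth_hess_op oU sG posG sf) Ux.
  have dT := is_pd_trace dS; have ET := is_pdP Hx dT; rewrite -ET in dT.
  have dWi := is_pd_invarea oU sG symG posG sf (k := k) Ux.
  apply: is_pdD.
    apply: is_pdD.
      apply: is_pdD.
        apply: is_pdD => //; apply: is_pdN; apply: is_pdM; last exact: is_pdM.
        rewrite dot_add; apply: is_pd_pairing => //.
        exact: is_dm_covector (smooth_grad_hess oU sG posG sf) Ux.
      rewrite dot_add; apply: is_pd_pairing => //; rewrite hessE.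
      exact: is_dm_covector (smooth_differential sh) Ux.
    apply: is_pdN; rewrite mxE; exact: (@is_pd_derive1n_comp 1).
  rewrite -[X in is_pd _ _ _ X]add0r -[0](mul0r (W x)).
  by apply: is_pdM; [exact: is_pd_cst|exact: (is_pd_area oU sG symG posG sf)].
have : \sum_k D x 0 k * (pd k (fun y => \tr (S y)) x
    - (((row k (Hb x) *m (D x)^T) 0 0 + (row k (S x) *m (b x)^T) 0 0)
         * ((W x)^-1 * (W x)^-1)
       + beta x * (- b x 0 k * (W x)^-1 ^+ 3 * (W x)^-1
                   + (W x)^-1 * (- b x 0 k * (W x)^-1 ^+ 3)))
    + ((row k (hess G h x) *m (D x)^T) 0 0
       + (row k (S x) *m (differential h x)^T) 0 0)
    - derive1n 2 v (f x) * p x 0 k + H * (b x 0 k / W x)) = 0.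
  by rewrite big1// => k _; rewrite ek mulr0.
have sDp : \sum_k D x 0 k * p x 0 k = (p x *m (D x)^T) 0 0.
  by rewrite dot_sym [RHS]mxE; apply: eq_bigr => k _; rewrite [(_^T) k 0]mxE.
have sDb : \sum_k D x 0 k * b x 0 k = beta x.
  rewrite /hess_grad_grad dot_sym [RHS]mxE.
  by apply: eq_bigr => k _; rewrite [(_^T) k 0]mxE.
have E1 := dot_row (D x) (D x) (Hb x).
have E2 := dot_row (D x) (b x) (S x).
have E3 : inner (hess G h x) (D x) (D x) = _ := dot_row (D x) (D x) (hess G h x).
have E4 := dot_row (D x) (differential h x) (S x).
have sGi := inverse_metric_sym symG Ux.
rewrite -(raise_grad_hess G f) in E2 E4.
rewrite (dot_tr _ _ sGi) in E4.
rewrite sum_mean_curvature_defect sDp sDb -E1 -E2 -E3 -E4.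
by rewrite expr2.
Qed.

(** The square of [F *m invmx (gt x) = S - W^-2 b^T D] is expanded; the left-hand side is the
    squared norm of the Hessian in the graph metric. *)
Lemma mxtrace_graph_hess_sqr x : U x ->
  \tr (invmx (gt x) *m F x *m invmx (gt x) *m F x) =
  \tr (S x *m S x) - 2 * (W x)^-1 ^+ 2 * (b x *m Gi x *m (b x)^T) 0 0
  + (W x)^-1 ^+ 4 * beta x ^+ 2.
Proof.
move=> Ux; transitivity (\tr (F x *m invmx (gt x) *m (F x *m invmx (gt x)))).
  by rewrite -!mulmxA mxtrace_mulC !mulmxA.
have -> : F x *m invmx (gt x) = S x - (W x)^-1 ^+ 2 *: ((b x)^T *m D x).
  rewrite (graph_metricV symG posG)// mulmxBr -scalemxAr mulmxA.
  by rewrite (tr_grad_hess oU sG symG sf).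
rewrite raise_grad_hess -/(hess_grad_grad G f x) /hess_grad_grad.
move: (S x) (b x) (D x) (W x)^-1 => A u w c.
have trB (X Y : 'M[R]_d.+1) : \tr (X - Y) = \tr X - \tr Y by exact: raddfB.
rewrite mulmxBr !mulmxBl -!scalemxAl -!scalemxAr !trB !mxtraceZ.
rewrite (mxtrace_outer u w A) -[u^T *m w *m A]mulmxA.
rewrite [\tr (u^T *m (w *m A))]mxtrace_mulC.
rewrite trace_mx11 mxtrace_outer.
have -> : (w *m (u^T *m w) *m u^T) 0 0 = (u *m w^T) 0 0 ^+ 2.
  have mul11 (X Y : 'M[R]_1) : (X *m Y) 0 0 = X 0 0 * Y 0 0.
    by rewrite mxE big_ord1.
  by rewrite mulmxA -mulmxA mul11 dot_sym expr2.
by ring.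
Qed.

Lemma weighted_laplacian_cmc x : U x ->
  W x ^+ 3 * weighted_laplacian gt (fun y => h y + v (f y)) (angle G f) x =
  inner (bakry_emery G h x) (D x) (D x)
  + derive1n 2 v (f x) * inner (G x) (D x) (D x)
  + \tr (invmx (gt x) *m F x *m invmx (gt x) *m F x).
Proof.
move=> Ux; have W0 := area_neq0 posG f Ux.
rewrite (weighted_laplacian_angle oU sG symG posG sf)//.
rewrite mxtrace_graph_hess_sqr// (inner_grad posG)// differential_weight//.
rewrite (bochner oU sG symG posG sf)//.
have subE (X Y : 'M[R]_1) : (X - Y) 0 0 = X 0 0 - Y 0 0 by rewrite !mxE.
have axpyE a (X Y : 'M[R]_1) : (X + a *: Y) 0 0 = X 0 0 + a * Y 0 0.
  by rewrite !mxE.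
have -> : inner (bakry_emery G h x) (D x) (D x) =
    inner (ricci G x) (D x) (D x) - inner (hess G h x) (D x) (D x).
  by rewrite /inner /bakry_emery mulmxBr mulmxBl subE.
have -> : ((differential h x + derive1 v (f x) *: p x) *m invmx (G x)
    *m (b x)^T) 0 0 =
    (differential h x *m Gi x *m (b x)^T) 0 0 + derive1 v (f x) * beta x.
  by rewrite !mulmxDl -!scalemxAl -gradE axpyE (dot_sym (D x)).
have -> : ((differential h x + derive1 v (f x) *: p x) *m (D x)^T) 0 0 =
    (differential h x *m (D x)^T) 0 0 + derive1 v (f x) * (p x *m (D x)^T) 0 0.
  by rewrite mulmxDl -scalemxAl axpyE.
have := grad_mean_curvature_defect Ux; have := cH Ux.
rewrite /mean_curvature_defect.
have -> : (p x *m (D x)^T) 0 0 = W x * W x - 1.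
  by rewrite (area_sqr posG)// addrC addKr.
move: W0 (\sum_k _) (inner (ricci _ _) _ _) (inner (hess _ _ _) _ _).
move: (\tr (S x *m S x)) (\tr (S x)) (beta x) (derive1 v (f x)).
move: ((differential h x *m invmx (G x) *m (b x)^T) 0 0).
move: ((differential h x *m (D x)^T) 0 0) (derive1n 2 v (f x)).
move: ((D x *m Hb x *m (D x)^T) 0 0) ((b x *m invmx (G x) *m (b x)^T) 0 0).
move: (W x) => w A B hD v2 hb tSS tS be v1 w0 X1 ri he e1 e2.
(* The trace of [S] is eliminated by the mean curvature equation, and its derivative along [D] by
   the differentiated equation. What remains is an identity of rational functions with denominators
   powers of [w]. *)
have tSE : tS = be * (w^-1 * w^-1) - hD + v1 - H * w.
  by rewrite -[LHS]subr0 -e1; ring.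
have X1E : X1 = w^-1 ^+ 2 * (A + B) - 2 * w^-1 ^+ 4 * be ^+ 2 - he - hb
    + v2 * (w * w - 1) - H * (be * w^-1).
  by rewrite -[LHS]subr0 -e2; ring.
by rewrite tSE X1E; field.
Qed.

End Constant_mean_curvature.

(** * The cylinder over a chart *)

Section Cylinder.
Variables (R : realType) (d : nat).
Local Notation V := 'rV[R]_d.+1.
Local Notation e := (d + 1)%N.
Local Notation Vc := 'rV[R]_(d.+1 + 1).
Local Notation sp := (@space_part R d).
Local Notation ht := (@height R d).
Local Notation vert := (rshift d.+1 (0 : 'I_1)).
Implicit Types (x : V) (y : Vc) (i j k : 'I_d.+1).

Lemma space_partE y i : sp y 0 i = y 0 (lshift 1 i).
Proof. by rewrite mxE. Qed.

Lemma heightE y : ht y = y 0 vert.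
Proof. by rewrite /height mxE. Qed.

Lemma ord0_lshift : (ord0 : 'I_e.+1) = lshift 1 (ord0 : 'I_d.+1).
Proof. exact: val_inj. Qed.

Lemma halfspace_space_part y : halfspace R d (sp y) = halfspace R e y.
Proof. by rewrite /halfspace /= space_partE -ord0_lshift. Qed.

Lemma space_part_lshift i y s :
  sp (@axis_line R e (lshift 1 i) y s) = axis_line i (sp y) s.
Proof.
apply/rowP => j; rewrite space_partE axis_lineE [LHS]axis_lineE space_partE.
by have -> : ((lshift 1 j : 'I_e.+1) == lshift 1 i) = (j == i)
  by exact: (inj_eq (@lshift_inj _ _)).
Qed.

Lemma height_lshift i y s : ht (@axis_line R e (lshift 1 i) y s) = ht y.
Proof. rewrite !heightE [LHS]axis_lineE.
have -> : ((vert : 'I_e.+1) == lshift 1 i) = false.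
  by rewrite -val_eqE /= addn0 gtn_eqF.
by rewrite mulr0 addr0. Qed.

Lemma space_part_rshift y s : sp (@axis_line R e vert y s) = sp y.
Proof.
apply/rowP => j; rewrite !space_partE [LHS]axis_lineE.
have -> : ((lshift 1 j : 'I_e.+1) == vert) = false.
  by rewrite -val_eqE /= addn0 ltn_eqF.
by rewrite mulr0 addr0.
Qed.

Lemma height_rshift y s : ht (@axis_line R e vert y s) = ht y + s.
Proof. rewrite !heightE [LHS]axis_lineE.
have -> : ((vert : 'I_e.+1) == vert) = true by exact: eqxx.
by rewrite mulr1. Qed.

Lemma is_pd_space i (g : V -> R) y l : is_pd i g (sp y) l ->
  @is_pd R e (lshift 1 i) (g \o sp) y l.
Proof.
suff E : quotient_in (@axis_line R e (lshift 1 i) y @^-1` halfspace R e)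
     ((g \o sp) \o @axis_line R e (lshift 1 i) y) 0 =
   quotient_in (axis_line i (sp y) @^-1` halfspace R d)
     (g \o axis_line i (sp y)) 0.
  by rewrite /is_pd E.
congr (quotient_in _ _ _); apply/funext => s /=.
  by rewrite -space_part_lshift halfspace_space_part.
by rewrite space_part_lshift.
Qed.

Lemma is_pd_const_along (c : 'I_e.+1) (g : Vc -> R) y :
  (forall s, g (@axis_line R e c y s) = g y) -> @is_pd R e c g y 0.
Proof.
move=> gc; rewrite /is_pd.
have -> : g \o @axis_line R e c y = fun=> g y by apply/funext.
exact: cvg_quotient_cst.
Qed.

Lemma is_pd_height y : @is_pd R e vert ht y 1.
Proof.
rewrite /is_pd /quotient_in.
have E s : (ht (@axis_line R e vert y s) - ht (@axis_line R e vert y 0)) =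
  s - 0 by rewrite !height_rshift; ring.
set A := within _ _; apply: (@cvg_trans _ ((fun=> (1 : R)) @ A)); last exact: cvg_cst.
apply: near_eq_cvg; rewrite /A.
rewrite near_withinE near_withinE; near=> s => s0 _.
by rewrite /= E divff// subr0.
Unshelve. all: end_near. Qed.

Variables (U : set V) (G : V -> 'M[R]_d.+1).
Hypothesis oU : rel_open U.
Hypothesis sG : smooth_mx U G.
Hypothesis symG : forall x, U x -> (G x)^T = G x.
Hypothesis posG : forall x, U x -> forall w : V, w != 0 -> 0 < inner (G x) w w.

Definition cylinder_metric y : 'M[R]_(d.+1 + 1) :=
  block_mx (G (sp y)) 0 0 1%:M.
Local Notation cG := cylinder_metric.

Lemma invmx_cylinder_metric y : U (sp y) ->
  invmx (cG y) = block_mx (invmx (G (sp y))) 0 0 1%:M.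
Proof.
move=> Uy; have uG := metric_unit posG Uy.
have E : cG y *m block_mx (invmx (G (sp y))) 0 0 1%:M = 1%:M.
  rewrite mulmx_block mulmxV// !mulmx0 !mul0mx !mulmx1 !addr0 add0r.
  by rewrite -scalar_mx_block.
have [ucG _] := mulmx1_unit E.
by apply: (can_inj (mulKmx ucG)); rewrite mulmxV.
Qed.

Lemma inner_cylinder y (u w : V) (a c : R) :
  inner (cG y) (row_mx u (const_mx a)) (row_mx w (const_mx c)) =
  inner (G (sp y)) u w + a * c.
Proof.
rewrite /inner mul_row_block tr_row_mx mul_row_col !mulmx0 addr0 add0r mulmx1.
by rewrite mxE; congr (_ + _); rewrite mxE big_ord1 !mxE.
Qed.

(** Only the horizontal block varies, and only in horizontal directions. Indices are analysed with
    [split] because the cylinder has [d.+1 + 1] coordinates, seen as the successor of [d + 1]. *)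
Lemma pd_cylinder_metric (c : 'I_e.+1) y (a a' : 'I_(d.+1 + 1)) : U (sp y) ->
  @pd R e c (fun z => cG z a a') y =
  match fintype.split (c : 'I_(d.+1 + 1)), fintype.split a, fintype.split a' with
  | inl k, inl i, inl j => pd k (fun x => G x i j) (sp y)
  | _, _, _ => 0
  end.
Proof.
move=> Uy.
have Hy : halfspace R e y.
  by rewrite -halfspace_space_part; exact: (rel_open_sub oU).
apply: is_pdP => //.
have -> : (c : 'I_(d.+1 + 1)) = unsplit (fintype.split (c : 'I_(d.+1 + 1))).
  by rewrite splitK.
have -> : a = unsplit (fintype.split a) by rewrite splitK.
have -> : a' = unsplit (fintype.split a') by rewrite splitK.
rewrite !unsplitK; case: (fintype.split a) => i; case: (fintype.split a') => j /=.
- under [X in is_pd _ X]eq_fun do rewrite /cylinder_metric block_mxEul.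
  case: (fintype.split (c : 'I_(d.+1 + 1))) => [k|k] /=; last first.
    apply: is_pd_const_along => s; rewrite (ord1 k).
    by rewrite space_part_rshift.
  apply: (@is_pd_space k (fun x => G x i j)).
  exact: Cinfty_is_pd.
- case: (fintype.split (c : 'I_(d.+1 + 1))) => k; apply: is_pd_const_along => s;
  by rewrite /cylinder_metric !block_mxEur !mxE.
- case: (fintype.split (c : 'I_(d.+1 + 1))) => k; apply: is_pd_const_along => s;
  by rewrite /cylinder_metric !block_mxEdl !mxE.
- case: (fintype.split (c : 'I_(d.+1 + 1))) => k; apply: is_pd_const_along => s;
  by rewrite /cylinder_metric !block_mxEdr !mxE.
Qed.

End Cylinder.

Lemma is_pd_coord (R : realType) (d : nat) i k (x : 'rV[R]_d.+1) :
  is_pd i (fun y => y 0 k) x (k == i)%:R.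
Proof.
rewrite /is_pd /quotient_in; set A := within _ _.
apply: (@cvg_trans _ ((fun=> ((k == i)%:R : R)) @ A)); last exact: cvg_cst.
apply: near_eq_cvg; rewrite /A.
rewrite near_withinE near_withinE; near=> s => s0 _.
rewrite /= !axis_lineE subr0 mul0r addr0 addrC addKr mulrC mulKf//.
Unshelve. all: end_near. Qed.

(** * Second fundamental form of the graph in the cylinder *)

Section Cylinder_graph.
Variables (R : realType) (d : nat).
Local Notation V := 'rV[R]_d.+1.
Local Notation e := (d + 1)%N.
Local Notation Vc := 'rV[R]_(d.+1 + 1).
Local Notation sp := (@space_part R d).
Local Notation ht := (@height R d).
Local Notation vert := (rshift d.+1 (0 : 'I_1)).
Implicit Types (x : V) (y : Vc) (i j k : 'I_d.+1).
Variables (U : set V) (G : V -> 'M[R]_d.+1).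
Hypothesis oU : rel_open U.
Hypothesis sG : smooth_mx U G.
Hypothesis symG : forall x, U x -> (G x)^T = G x.
Hypothesis posG : forall x, U x -> forall w : V, w != 0 -> 0 < inner (G x) w w.
Local Notation cG := (cylinder_metric G).

Lemma sum_cylinder (F : 'I_e.+1 -> R) :
  \sum_b F b = \sum_(i < d.+1) F (lshift 1 i) + F vert.
Proof.
have := @big_split_ord R 0 +%R d.+1 1 predT F.
by rewrite big_ord1.
Qed.

Let splitl i : fintype.split (lshift 1 i) = inl i := unsplitK (inl i).
Let splitr : fintype.split vert = inr 0 := @unsplitK d.+1 1 (inr 0).

Lemma christoffel_cylinder (a b c : 'I_(d.+1 + 1)) y : U (sp y) ->
  @christoffel R e cG a b c y =
  match fintype.split a, fintype.split b, fintype.split c with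
  | inl a', inl i, inl j => christoffel G a' i j (sp y)
  | _, _, _ => 0
  end.
Proof.
move=> Uy; rewrite /christoffel sum_cylinder.
rewrite !(pd_cylinder_metric oU sG)// (invmx_cylinder_metric posG)//.
under eq_bigr => k _ do rewrite !(pd_cylinder_metric oU sG)// !splitl.
rewrite splitr.
have -> : a = unsplit (fintype.split a) by rewrite splitK.
have -> : b = unsplit (fintype.split b) by rewrite splitK.
have -> : c = unsplit (fintype.split c) by rewrite splitK.
rewrite !unsplitK; case: (fintype.split a) => a'; case: (fintype.split b) => i;
  case: (fintype.split c) => j /=;
  rewrite ?addr0 ?subr0 ?mulr0 ?addr0 ?mulr0//.
  congr (_ * _); apply: eq_bigr => k _; congr (_ * _).
  exact: block_mxEul.
all: rewrite big1 ?mulr0// => k _; rewrite ?mulr0//.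
(* The case of a vertical upper index and horizontal lower ones: the derivatives of the metric may
   be nonzero, but they meet the zero block of the inverse metric. *)
apply/eqP; rewrite mulf_eq0; apply/orP; left; apply/eqP.
by apply: etrans (block_mxEdl _ _ _ _ _ _) _; rewrite mxE.
Qed.

Variable f : V -> R.
Hypothesis sf : Cinfty U f.

Local Notation D := (grad G f).
Local Notation F := (hess G f).
Local Notation S := (hess_op G f).
Local Notation b := (grad_hess G f).
Local Notation W := (area G f).
Local Notation gt := (graph_metric G f).

Definition graph_map x : Vc := row_mx x (const_mx (f x)).
Local Notation X := graph_map.

Definition downward_normal x : Vc :=
  (W x)^-1 *: row_mx (D x) (const_mx (- 1)).
Local Notation N := downward_normal.

Lemma space_graph x : sp (X x) = x.
Proof. by rewrite /space_part row_mxKl. Qed.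

Lemma height_graph x : ht (X x) = f x.
Proof. by rewrite /height row_mxKr mxE. Qed.

Lemma coord_tangent_graph i x : U x ->
  @coord_tangent R d e X i x = row_mx (delta_mx 0 i) (const_mx (pd i f x)).
Proof.
move=> Ux; apply/rowP => a; rewrite mxE.
have -> : (a : 'I_(d.+1 + 1)) = unsplit (fintype.split (a : 'I_(d.+1 + 1))).
  by rewrite splitK.
case: (fintype.split _) => k /=.
  transitivity (pd i (fun z : V => z 0 k) x).
    by congr (pd i _ x); apply/funext => y; exact: row_mxEl.
  rewrite [RHS]row_mxEl mxE eqxx /=; apply: is_pdP; last exact: is_pd_coord.
  exact: (rel_open_sub oU).
rewrite [RHS]row_mxEr mxE; congr (pd i _ x); apply/funext => y.
by apply: etrans (row_mxEr _ _ _ _) _; rewrite mxE.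
Qed.

Lemma inner_delta (A : 'M[R]_d.+1) i j :
  inner A (delta_mx 0 i) (delta_mx 0 j) = A i j.
Proof. by rewrite /inner -rowE trmx_delta -colE !mxE. Qed.

Lemma induced_metric_graph x : U x -> @induced_metric R d e cG X x = gt x.
Proof.
move=> Ux; apply/matrixP => i j; rewrite [LHS]mxE !coord_tangent_graph//.
have := @inner_cylinder R d G (X x).
move=> ->; rewrite space_graph inner_delta.
by rewrite [RHS]mxE; congr (_ + _); rewrite mxE big_ord1 !mxE.
Qed.

(** Christoffel symbols with a vertical index vanish, so the horizontal part is differentiated
    covariantly in [M] and the vertical part as a function. *)
Lemma cov_der_graph (n : V -> V) (n0 : V -> R) i x : U x ->
  @cov_der R d e cG X (fun z => row_mx (n z) (const_mx (n0 z))) i x =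
  row_mx (dm i n x + n x *m conn G i x) (const_mx (pd i n0 x)).
Proof.
move=> Ux; have Us : U (sp (X x)) by rewrite space_graph.
pose Nx : Vc := row_mx (n x) (const_mx (n0 x)).
have NE j : Nx 0 (lshift 1 j) = n x 0 j by rewrite row_mxEl.
pose T : 'rV[R]_(d.+1 + 1) := row_mx (delta_mx 0 i) (const_mx (pd i f x)).
have TE j : T 0 (lshift 1 j) = (j == i)%:R by rewrite row_mxEl mxE.
pose C a b c := @christoffel R e cG a b c (X x).
have C1 a c : C a vert c = 0.
  by rewrite /C christoffel_cylinder// splitr; case: (fintype.split (a : 'I_(d.+1 + 1))).
have C2 a b : C a b vert = 0.
  by rewrite /C christoffel_cylinder// splitr; case: (fintype.split (a : 'I_(d.+1 + 1)));
    case: (fintype.split (b : 'I_(d.+1 + 1))).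
have sumE a : \sum_b \sum_c C a b c * T 0 b * Nx 0 c =
    \sum_(j < d.+1) C a (lshift 1 i) (lshift 1 j) * n x 0 j.
  rewrite sum_cylinder [X in _ + X]big1 ?addr0; last first.
    by move=> c _; rewrite C1 !mul0r.
  rewrite (bigD1 i)//= [X in _ + X]big1 ?addr0; last first.
    by move=> k ki; apply: big1 => c _; rewrite TE (negbTE ki) mulr0 mul0r.
  rewrite sum_cylinder C2 !mul0r addr0.
  by apply: eq_bigr => j _; rewrite TE eqxx mulr1 NE.
apply/rowP => a; rewrite mxE coord_tangent_graph// -/Nx -/T.
apply: etrans (congr1 _ (sumE a)) _.
have -> : (a : 'I_(d.+1 + 1)) = unsplit (fintype.split (a : 'I_(d.+1 + 1))).
  by rewrite splitK.
case: (fintype.split _) => k /=.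
  rewrite [RHS]row_mxEl !mxE; congr (_ + _).
    by congr (pd i _ x); apply/funext => z; exact: row_mxEl.
  apply: eq_bigr => j _; rewrite /C christoffel_cylinder// !splitl space_graph.
  by rewrite !mxE mulrC.
rewrite [RHS]row_mxEr mxE big1 ?addr0 => [|j _].
  congr (pd i _ x); apply/funext => z.
  by apply: etrans (row_mxEr _ _ _ _) _; rewrite mxE.
by rewrite /C christoffel_cylinder// (ord1 k) splitr mul0r.
Qed.

Lemma downward_normalE x :
  N x = row_mx ((W x)^-1 *: D x) (const_mx (- (W x)^-1)).
Proof.
rewrite /N scale_row_mx; congr row_mx.
by apply/matrixP => i j; rewrite !mxE mulrN1.
Qed.

(** The derivative of the factor [W^-1] of the normal contributes a multiple of the normal, which is
    orthogonal to the tangent vectors. Only [W^-1] times the Hessian of [f] is left. *)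
Lemma surface_div_graph x : U x ->
  @surface_div R d e cG X N x = (W x)^-1 * \tr (F x *m invmx (gt x)).
Proof.
move=> Ux; have Us : U (sp (X x)) by rewrite space_graph.
rewrite /surface_div induced_metric_graph//.
have dWi i := is_pd_invarea oU sG symG posG sf (k := i) Ux.
have E i j : inner (cG (X x)) (@cov_der R d e cG X N i x)
     (@coord_tangent R d e X j x) = (W x)^-1 * F x i j.
  have -> : N = fun z => row_mx ((W z)^-1 *: D z) (const_mx (- (W z)^-1)).
    by apply/funext => z; exact: downward_normalE.
  rewrite cov_der_graph// coord_tangent_graph//.
  apply: etrans (inner_cylinder _ _ _ _ _ _) _; rewrite space_graph.
  have -> : pd i (fun z => - (W z)^-1) x = b x 0 i * (W x)^-1 ^+ 3.
    apply: is_pdP; first exact: (rel_open_sub oU).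
    exact: (is_pd_angle oU sG symG posG sf).
  have -> : dm i (fun z => (W z)^-1 *: D z) x =
     (- b x 0 i * (W x)^-1 ^+ 3) *: D x
     + (W x)^-1 *: (row i (S x) - D x *m conn G i x).
    apply: (is_dm_unique (rel_open_sub oU Ux) (A := fun z => (W z)^-1 *: D z)).
      apply: (smooth_is_dm _ Ux) => k l.
      under [X in Cinfty _ X]eq_fun do rewrite mxE.
      apply: CinftyM => //; last exact: (smooth_grad oU sG posG sf).
      apply: CinftyV => //; first by move=> z Uz; exact: (area_neq0 posG f Uz).
      exact: (smooth_area oU sG posG sf).
    move=> k l; under [X in is_pd _ X]eq_fun do rewrite mxE.
    have /(_ k l) dD := is_dm_grad oU sG symG posG sf (k := i) Ux.
    have := is_pdM (dWi i) dD.
    by congr (is_pd _ _ _ _); rewrite [RHS]mxE; congr (_ + _); rewrite [RHS]mxE.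
  have -> : (- b x 0 i * (W x)^-1 ^+ 3) *: D x
     + (W x)^-1 *: (row i (S x) - D x *m conn G i x)
     + (W x)^-1 *: D x *m conn G i x =
     (- b x 0 i * (W x)^-1 ^+ 3) *: D x + (W x)^-1 *: row i (S x).
    by rewrite -scalemxAl -addrA -scalerDr subrK.
  rewrite /inner mulmxDl mulmxDl -!scalemxAl (grad_metric posG)//.
  rewrite -row_mul /hess_op mulmxKV ?(metric_unit posG)// trmx_delta -!colE.
  by rewrite !mxE; ring.
under eq_bigr => i _ do under eq_bigr => j _ do rewrite E.
rewrite /mxtrace mulr_sumr; apply: eq_bigr => i _.
rewrite mxE mulr_sumr; apply: eq_bigr => j _.
rewrite -[in LHS](graph_metricV_sym symG f Ux) [X in X * _]mxE.
by rewrite mulrCA [_ * F x i j]mulrC.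
Qed.

End Cylinder_graph.

Section Graph_mean_curvature.
Variables (R : realType) (d : nat).
Local Notation V := 'rV[R]_d.+1.
Local Notation e := (d + 1)%N.
Local Notation Vc := 'rV[R]_(d.+1 + 1).
Local Notation sp := (@space_part R d).
Local Notation ht := (@height R d).
Implicit Types (x : V) (y : Vc) (i j k : 'I_d.+1).
Variables (U : set V) (G : V -> 'M[R]_d.+1).
Hypothesis oU : rel_open U.
Hypothesis sG : smooth_mx U G.
Hypothesis symG : forall x, U x -> (G x)^T = G x.
Hypothesis posG : forall x, U x -> forall w : V, w != 0 -> 0 < inner (G x) w w.
Variables (f h : V -> R) (v : R -> R).
Hypothesis sf : Cinfty U f.
Hypothesis sh : Cinfty U h.
Hypothesis sv : forall (m : nat) (t : R), derivable (derive1n m v) t 1.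
Local Notation cG := (cylinder_metric G).
Local Notation D := (grad G f).
Local Notation F := (hess G f).
Local Notation S := (hess_op G f).
Local Notation W := (area G f).
Local Notation gt := (graph_metric G f).
Local Notation X := (graph_map f).
Local Notation N := (downward_normal G f).

Lemma cylinder_metric_unit y : U (sp y) -> cG y \in unitmx.
Proof.
move=> Uy; rewrite unitmxE det_ublock det1 mulr1 -unitmxE.
exact: (metric_unit posG).
Qed.

Lemma differential_cylinder x : U x ->
  \row_a @pd R e a (fun y => h (sp y) + v (ht y)) (X x) =
  row_mx (differential h x) (const_mx (derive1 v (f x))) :> Vc.
Proof.
move=> Ux; have Us : U (sp (X x)) by rewrite space_graph.
have HX : halfspace R e (X x).
  by rewrite -halfspace_space_part; exact: (rel_open_sub oU).
apply/rowP => a; rewrite mxE.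
have -> : (a : 'I_(d.+1 + 1)) = unsplit (fintype.split (a : 'I_(d.+1 + 1))).
  by rewrite splitK.
case: (fintype.split _) => k /=; apply: is_pdP => //.
  rewrite row_mxEl mxE -[pd k h x]addr0; apply: is_pdD.
    apply: (is_pd_space (g := h)); rewrite space_graph.
    exact: Cinfty_is_pd.
  by apply: is_pd_const_along => s; rewrite height_lshift.
rewrite row_mxEr mxE -[derive1 v (f x)]add0r (ord1 k); apply: is_pdD.
  by apply: is_pd_const_along => s; rewrite space_part_rshift.
rewrite -[derive1 v (f x)]mulr1; apply: (is_pd_comp (g := v)).
  exact: is_pd_height.
rewrite height_graph; exact: (is_derive_derive1n sv 0).
Qed.

Lemma weighted_mean_curvature_graph x : U x ->
  @weighted_mean_curvature R d e cG (fun y => h (sp y) + v (ht y)) X N x =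
  - ((W x)^-1 * \tr (F x *m invmx (gt x)))
  - (W x)^-1 * ((differential h x *m (D x)^T) 0 0 - derive1 v (f x)).
Proof.
move=> Ux; have Us : U (sp (X x)) by rewrite space_graph.
rewrite /weighted_mean_curvature (surface_div_graph oU sG symG posG sf)//.
congr (_ - _); rewrite /inner.
have -> : @grad R e cG (fun y => h (sp y) + v (ht y)) (X x) *m cG (X x) =
    row_mx (differential h x) (const_mx (derive1 v (f x))) :> Vc.
  rewrite -differential_cylinder//.
  by apply: mulmxKV; exact: cylinder_metric_unit.
rewrite downward_normalE.
have dotE (u w : V) (a c : R) : (row_mx u (const_mx a : 'rV_1)
    *m (row_mx w (const_mx c))^T) 0 0 = (u *m w^T) 0 0 + a * c.
  by rewrite tr_row_mx mul_row_col mxE; congr (_ + _); rewrite mxE big_ord1 !mxE.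
apply: etrans (dotE _ _ _ _) _; rewrite linearZ /= -scalemxAr mxE.
by rewrite mulrN [_ / _]mulrC mulrBr.
Qed.

Lemma cmc_defect (H : R) x : U x ->
  @weighted_mean_curvature R d e cG (fun y => h (sp y) + v (ht y)) X N x = H ->
  mean_curvature_defect G f h v H x = 0.
Proof.
move=> Ux <-; rewrite weighted_mean_curvature_graph// /mean_curvature_defect.
have W0 := area_neq0 posG f Ux.
have -> : \tr (F x *m invmx (gt x)) =
    \tr (S x) - (W x)^-1 ^+ 2 * hess_grad_grad G f x.
  rewrite (graph_metricV symG posG)// mulmxBr raddfB /= -scalemxAr mxtraceZ.
  by rewrite mxtrace_outer.
by move: (\tr _) (hess_grad_grad _ _ _) W0 => t1 t2 W0; field.
Qed.

End Graph_mean_curvature.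

(** * Unit normals and the free boundary condition *)

Section Unit_normal.
Variables (R : realType) (d : nat).
Local Notation V := 'rV[R]_d.+1.

(** Orthogonality to the boundary hyperplane leaves only the first component of the covector of
    [nu]; its sign follows from [inner A nu nu = 1] and [0 < nu 0 ord0]. *)
Lemma inner_unit_normalE (A : 'M[R]_d.+1) (nu : V) :
  inner_unit_normal A nu ->
  exists2 c : R, 0 < c & nu *m A = c *: delta_mx 0 ord0.
Proof.
move=> [nu0 nu1 nuw]; pose c := (nu *m A) 0 ord0.
have E : nu *m A = c *: delta_mx 0 ord0.
  apply/rowP => j; rewrite [RHS]mxE [X in _ = _ * X]mxE eqxx /=.
  have [->|j0] := eqVneq j ord0; first by rewrite mulr1.
  have := nuw (delta_mx 0 j); rewrite mxE eq_sym (negbTE j0) andbF => /(_ erefl).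
  by rewrite /inner trmx_delta -colE mxE mulr0.
exists c => //; move: nu1; rewrite /inner E -scalemxAl mxE -rowE !mxE => cn.
by rewrite -(pmulr_lgt0 _ nu0) cn ltr01.
Qed.

(** The gradient of the first coordinate, normalized. Its squared length is its own first
    component. *)
Lemma inner_unit_normal_exists (A : 'M[R]_d.+1) : A^T = A ->
  (forall w : V, w != 0 -> 0 < inner A w w) ->
  exists nu : V, inner_unit_normal A nu.
Proof.
move=> sA pA; have uA := posdef_unit pA.
pose n : V := delta_mx 0 ord0 *m invmx A.
have nA : n *m A = delta_mx 0 ord0 by rewrite mulmxKV.
have nw (w : V) : inner A n w = w 0 ord0.
  by rewrite /inner nA -rowE !mxE.
have n0 : n != 0.
  apply/eqP => n0; move: nA; rewrite n0 mul0mx => /rowP/(_ ord0).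
  by rewrite !mxE !eqxx => /eqP; rewrite eq_sym oner_eq0.
have g0 : 0 < n 0 ord0 by rewrite -nw pA.
have s0 : 0 < Num.sqrt (n 0 ord0) by rewrite sqrtr_gt0.
exists ((Num.sqrt (n 0 ord0))^-1 *: n); split.
- by rewrite mxE mulr_gt0// invr_gt0.
- rewrite /inner linearZ /= -!scalemxAl -scalemxAr scalerA mxE.
  rewrite -[X in _ * X]/(inner A n n) nw -invfM -expr2 sqr_sqrtr ?(ltW g0)//.
  by rewrite mulVf// gt_eqF.
- move=> w w0; rewrite /inner -!scalemxAl mxE.
  by rewrite -[X in _ * X]/(inner A n w) nw w0 mulr0.
Qed.

End Unit_normal.

Section Free_boundary.
Variables (R : realType) (d : nat).
Local Notation V := 'rV[R]_d.+1.
Local Notation e := (d + 1)%N.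
Local Notation Vc := 'rV[R]_(d.+1 + 1).
Implicit Types (x : V) (i j k : 'I_d.+1).
Variables (U : set V) (G : V -> 'M[R]_d.+1).
Hypothesis oU : rel_open U.
Hypothesis sG : smooth_mx U G.
Hypothesis symG : forall x, U x -> (G x)^T = G x.
Hypothesis posG : forall x, U x -> forall w : V, w != 0 -> 0 < inner (G x) w w.
Variables (f : V -> R).
Hypothesis sf : Cinfty U f.
Local Notation cG := (cylinder_metric G).
Local Notation D := (grad G f).
Local Notation S := (hess_op G f).
Local Notation b := (grad_hess G f).
Local Notation W := (area G f).
Local Notation gt := (graph_metric G f).
Local Notation X := (graph_map f).
Local Notation N := (downward_normal G f).

Hypothesis free : forall x (eta : Vc), U x -> x 0 ord0 = 0 ->
  @inner_unit_normal R e (cG (X x)) eta -> inner (cG (X x)) (N x) eta = 0.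

(** The inner normal of the cylinder is horizontal, being [row_mx nu 0] with [nu] the one of [M].
    Orthogonality to the normal of the graph thus means that [D] is tangent to the boundary. *)
Lemma free_grad x : U x -> x 0 ord0 = 0 -> D x 0 ord0 = 0.
Proof.
move=> Ux x0.
have [nu nuP] := inner_unit_normal_exists (symG Ux) (posG Ux).
have [c c0 nuE] := inner_unit_normalE nuP.
have [nu0 nu1 nuw] := nuP.
have := free (eta := row_mx nu (const_mx 0)) Ux x0.
rewrite downward_normalE inner_cylinder space_graph mulr0 addr0.
have dotG w : inner (G x) w nu = c * w 0 ord0.
  by rewrite (inner_sym _ _ (symG Ux)) /inner nuE -scalemxAl -rowE !mxE.
rewrite dotG [((W x)^-1 *: D x) 0 ord0]mxE mulrCA => E.
suff : (W x)^-1 * (c * D x 0 ord0) = 0.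
  move=> /eqP; rewrite mulf_eq0 invr_eq0 (negbTE (area_neq0 posG f Ux)) /=.
  by rewrite mulf_eq0 (gt_eqF c0) /= => /eqP.
apply: E; split.
- by rewrite ord0_lshift; apply: (lt_le_trans nu0); rewrite (row_mxEl nu).
- by apply: etrans (inner_cylinder _ _ _ _ _ _) _; rewrite space_graph mulr0 addr0.
- move=> w w0; rewrite -[w : Vc](hsubmxK (w : Vc)).
  have -> : rsubmx (w : Vc) = const_mx (rsubmx (w : Vc) 0 0).
    by apply/matrixP => i j; rewrite !ord1 [RHS]mxE.
  apply: etrans (inner_cylinder _ _ _ _ _ _) _; rewrite space_graph mul0r addr0.
  by apply: nuw; rewrite mxE -ord0_lshift.
Qed.

(** The first component of [D] vanishes along the boundary, hence so do its tangential derivatives,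
    and [D] itself is tangential. Of the covariant derivative of [D] along [D] only the Christoffel
    terms remain. *)
Lemma boundary_hess_op x : U x -> x 0 ord0 = 0 ->
  (D x *m S x) 0 ord0 =
  \sum_i \sum_j christoffel G ord0 i j x * D x 0 i * D x 0 j.
Proof.
move=> Ux x0; rewrite mxE; apply: eq_bigr => i _.
have [->|i0] := eqVneq i ord0.
  rewrite free_grad// mul0r big1// => j _.
  by rewrite mulr0 mul0r.
(* For [i] other than [ord0] the axis through [x] stays in the boundary hyperplane. *)
have d0 : is_pd i (fun y => D y 0 ord0) x 0.
  apply: cvg_trans (@cvg_quotient_cst _ _ _ 0); apply: quotient_in_near.
    by rewrite /= axis_line0 free_grad.
  apply: filterS (rel_open_near i oU Ux) => s Us.
  by rewrite /= free_grad// axis_lineE eq_sym (negbTE i0) mulr0 addr0.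
have /(_ 0 ord0) dD := is_dm_grad oU sG symG posG sf (k := i) Ux.
have := is_pdP (rel_open_sub oU Ux) dD.
have subE (A B : V) : (A - B) 0 ord0 = A 0 ord0 - B 0 ord0 by rewrite !mxE.
rewrite (is_pdP (rel_open_sub oU Ux) d0) subE [row i _ 0 ord0]mxE.
move=> /esym/eqP; rewrite subr_eq0 => /eqP ->.
rewrite [(D x *m _) 0 _]mxE mulr_sumr; apply: eq_bigr => j _.
by rewrite [conn G i x j ord0]mxE mulrA mulrC mulrA.
Qed.

(** As [D] is tangential, both inverse metrics agree on the first coordinate covector, so [nu] is a
    positive multiple of [eta]. The differential [W^-3 b] of the angle paired with it gives the
    first component of [D *m S]. *)
Lemma conormal_derivative_angle x (eta nu : V) : U x -> x 0 ord0 = 0 ->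
  inner_unit_normal (G x) eta -> inner_unit_normal (gt x) nu ->
  exists2 m : R, 0 < m &
  \sum_i nu 0 i * pd i (angle G f) x = m * second_form G x eta (D x).
Proof.
move=> Ux x0 etaP nuP.
have [c c0 etaE] := inner_unit_normalE etaP.
have [a a0 nuE] := inner_unit_normalE nuP.
have ug := metric_unit (graph_metric_pos posG f) Ux.
have nuE' : nu = a *: (delta_mx 0 ord0 *m invmx (G x)).
  apply: (can_inj (mulmxK ug)); rewrite nuE -scalemxAl; congr (_ *: _).
  apply: (can_inj (mulmxK (_ : invmx (gt x) \in unitmx))).
    by rewrite unitmx_inv.
  rewrite mulmxK// (graph_metricV symG posG)// mulmxBr -scalemxAr mulmxA.
  have -> : (delta_mx 0 ord0 : V) *m (D x)^T = 0.
    by apply/matrixP => i j; rewrite (ord1 i) (ord1 j) -rowE 2!mxE free_grad// mxE.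
  by rewrite mul0mx scaler0 subr0.
have dotG w : inner (G x) w eta = c * w 0 ord0.
  by rewrite (inner_sym _ _ (symG Ux)) /inner etaE -scalemxAl -rowE !mxE.
(* The factors [a] and [c] normalize [nu] and [eta]; [W^-3] comes from the differential of the
   angle. *)
exists (a * (W x)^-1 ^+ 3 / c).
  by rewrite divr_gt0// mulr_gt0// exprn_gt0// invr_gt0 (area_gt0 posG).
rewrite /second_form dotG mxE -boundary_hess_op//.
have -> : \sum_i nu 0 i * pd i (angle G f) x =
    (nu *m (differential (angle G f) x)^T) 0 0.
  by rewrite [RHS]mxE; apply: eq_bigr => i _; rewrite !mxE.
rewrite (differential_angle oU sG symG posG sf)// nuE'.
rewrite linearZ /= -scalemxAr -scalemxAl mxE [X in _ * X]mxE.
have -> : ((delta_mx 0 ord0 : V) *m invmx (G x) *m (b x)^T) 0 0 = (D x *m S x) 0 ord0.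
  rewrite (dot_tr _ _ (inverse_metric_sym symG Ux)) raise_grad_hess.
  by rewrite trmx_delta -colE mxE.
move: ((D x *m S x) 0 ord0) => t; move: (W x)^-1 => w.
by field; rewrite gt_eqF.
Qed.

End Free_boundary.

(** * Rigidity *)

Section Congruence.
Variables (R : realType) (d : nat).
Local Notation V := 'rV[R]_d.+1.
Implicit Types (x : V) (i j k : 'I_d.+1).
Variable U : set V.
Hypothesis oU : rel_open U.

(** Global data agree with their local formulas only on the image of a chart; the values of
    [chart_inv] elsewhere are arbitrary. *)
Lemma weighted_laplacian_eq (A B : V -> 'M[R]_d.+1) g (u u' : V -> R) x :
  smooth_mx U A -> {in U, A =1 B} -> Cinfty U u -> {in U, u =1 u'} -> U x ->
  weighted_laplacian A g u x = weighted_laplacian B g u' x.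
Proof.
move=> sA AB su uu Ux; have xU : x \in U by rewrite inE.
have pA i j k : pd k (fun y => A y i j) x = pd k (fun y => B y i j) x.
  apply: (pd_in_eq oU) => // [y yU|y Uy]; first by rewrite AB.
  exact: is_pd_has (Cinfty_is_pd _ Uy).
have pu i : {in U, pd i u =1 pd i u'}.
  apply: (pd_in_eq oU) => // y Uy.
  exact: is_pd_has (Cinfty_is_pd _ Uy).
have ppu i j : pd i (pd j u) x = pd i (pd j u') x.
  apply: (pd_in_eq oU (pu j)) => // y Uy.
  by apply: is_pd_has (Cinfty_is_pd _ Uy); exact: Cinfty_pd.
have cA a i j : christoffel A a i j x = christoffel B a i j x.
  rewrite /christoffel AB//; congr (_ * _); apply: eq_bigr => l _.
  by rewrite !pA.
have hu : hess A u x = hess B u' x.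
  apply/matrixP => i j; rewrite !mxE ppu; congr (_ - _).
  by apply: eq_bigr => a _; rewrite cA pu.
have gu : grad A u x = grad B u' x.
  by rewrite /grad AB//; congr (_ *m _); apply/rowP => i; rewrite !mxE pu.
by rewrite /weighted_laplacian /laplacian hu gu /grad AB.
Qed.

Lemma weighted_laplacian_cst (A : V -> 'M[R]_d.+1) g u a x : U x ->
  {in U, u =1 fun=> a} -> weighted_laplacian A g u x = 0.
Proof.
move=> Ux ua.
have pu i : {in U, pd i u =1 fun=> 0}.
  move=> y; rewrite inE => Uy; apply: is_pdP; first exact: (rel_open_sub oU).
  by apply: (is_pd_eq oU Uy) (is_pd_cst i y a) => z /ua.
have ppu i j : pd i (pd j u) x = 0.
  apply: is_pdP; first exact: (rel_open_sub oU).
  by apply: (is_pd_eq oU Ux) (is_pd_cst i x 0) => z /(pu j).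
have xU : x \in U by rewrite inE.
have hu : hess A u x = 0.
  apply/matrixP => i j; rewrite !mxE ppu big1 ?subr0// => l _.
  by rewrite pu ?mulr0.
have gu : grad A u x = 0.
  rewrite /grad (_ : \row_i _ = 0) ?mul0mx//.
  by apply/rowP => i; rewrite !mxE pu.
rewrite /weighted_laplacian /laplacian hu gu /inner trmx0 mulmx0 mxE addr0.
by rewrite big1// => i _; rewrite big1// => j _; rewrite mxE mulr0.
Qed.

End Congruence.

(** * Sign of the weighted Laplacian of the angle, and the equality case *)

Section Subharmonicity.
Variables (R : realType) (d : nat).
Local Notation V := 'rV[R]_d.+1.
Implicit Types (x : V) (i j k : 'I_d.+1).
Variables (U : set V) (G : V -> 'M[R]_d.+1).
Hypothesis oU : rel_open U.
Hypothesis sG : smooth_mx U G.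
Hypothesis symG : forall x, U x -> (G x)^T = G x.
Hypothesis posG : forall x, U x -> forall w : V, w != 0 -> 0 < inner (G x) w w.
Variables (f h : V -> R) (v : R -> R) (H c : R).
Hypothesis sf : Cinfty U f.
Hypothesis sh : Cinfty U h.
Hypothesis sv : forall (m : nat) (t : R), derivable (derive1n m v) t 1.
Hypothesis cv : forall t, - (derive1n 2 v t) <= c.
Hypothesis cG : forall x, U x -> forall w : V,
  c * inner (G x) w w <= inner (bakry_emery G h x) w w.
Hypothesis cH : forall y, U y -> mean_curvature_defect G f h v H y = 0.
Local Notation D := (grad G f).
Local Notation F := (hess G f).
Local Notation gt := (graph_metric G f).
Local Notation psi := (fun y => h y + v (f y)).

Let hess_sqr x := \tr (invmx (gt x) *m F x *m invmx (gt x) *m F x).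

(** Subtracting and adding [c |D|^2] separates the two curvature hypotheses, so that each summand
    has a sign and vanishes when the sum does. *)
Lemma laplacian_angle_split x : U x ->
  [/\ 0 <= hess_sqr x,
      0 <= inner (bakry_emery G h x) (D x) (D x) - c * inner (G x) (D x) (D x),
      0 <= (derive1n 2 v (f x) + c) * inner (G x) (D x) (D x) &
      area G f x ^+ 3 * weighted_laplacian gt psi (angle G f) x =
      (inner (bakry_emery G h x) (D x) (D x) - c * inner (G x) (D x) (D x))
      + (derive1n 2 v (f x) + c) * inner (G x) (D x) (D x) + hess_sqr x].
Proof.
move=> Ux.
have [K KE _] := mxtrace_metric_sqr (graph_metric_sym symG f Ux)
  (hess_sym oU sG symG sf Ux) (graph_metric_pos posG f Ux).
split.
- by rewrite /hess_sqr KE mxtrace_sqr_ge0.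
- by rewrite subr_ge0 cG.
- by rewrite mulr_ge0 ?(inner_ge0 posG)// -lerBlDr sub0r lerNl.
- rewrite (weighted_laplacian_cmc oU sG symG posG sf sh sv cH)// -/(hess_sqr x).
  by ring.
Qed.

Lemma angle_subharmonic x : U x ->
  0 <= weighted_laplacian gt psi (angle G f) x.
Proof.
move=> Ux; have [h1 h2 h3 E] := laplacian_angle_split Ux.
have W3 : 0 < area G f x ^+ 3 by rewrite exprn_gt0// (area_gt0 posG).
by rewrite -(pmulr_rge0 _ W3) E; apply: addr_ge0 => //; exact: addr_ge0.
Qed.

Lemma angle_harmonic x : U x -> weighted_laplacian gt psi (angle G f) x = 0 ->
  [/\ inner (bakry_emery G h x) (D x) (D x) = c * inner (G x) (D x) (D x),
      (derive1n 2 v (f x) + c) * inner (G x) (D x) (D x) = 0 &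
      F x = 0].
Proof.
move=> Ux L0; have [h1 h2 h3] := laplacian_angle_split Ux.
rewrite L0 mulr0 => /esym/eqP.
rewrite (paddr_eq0 (addr_ge0 h2 h3) h1) (paddr_eq0 h2 h3).
move=> /andP[/andP[/eqP e1 /eqP e2] /eqP e3].
have [K KE K0] := mxtrace_metric_sqr (graph_metric_sym symG f Ux)
  (hess_sym oU sG symG sf Ux) (graph_metric_pos posG f Ux).
split=> //; first by apply/eqP; rewrite -subr_eq0 e1.
by apply: K0; apply: mxtrace_sqr_eq0; rewrite -KE.
Qed.

Lemma grad_eq0 x : U x -> inner (G x) (D x) (D x) = 0 -> D x = 0.
Proof.
move=> Ux D0; apply/eqP/negPn/negP => /(posG Ux).
by rewrite D0 ltxx.
Qed.

(** If the gradient does not vanish then [v' \o f] is constant while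
    [v'' = -c] along [f]. *)
Lemma harmonic_cst_weight a w x : U x -> {in U, h =1 fun=> a} -> c != 0 ->
  (forall y, U y -> inner (G y) (D y) (D y) = w) ->
  (forall y, U y -> weighted_laplacian gt psi (angle G f) y = 0) ->
  inner (G x) (D x) (D x) = 0.
Proof.
move=> Ux ha c0 Dw L0; rewrite Dw//; apply/eqP/negPn/negP => w0.
have v2 y : U y -> derive1n 2 v (f y) = - c.
  move=> Uy; have [_ /eqP + _] := angle_harmonic Uy (L0 y Uy).
  by rewrite Dw// mulf_eq0 (negbTE w0) orbF addr_eq0 => /eqP.
have v1 y : U y -> derive1 v (f y) = H * Num.sqrt (1 + w).
  move=> Uy; have [_ _ F0] := angle_harmonic Uy (L0 y Uy).
  have := cH Uy; rewrite /mean_curvature_defect /hess_op /hess_grad_grad.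
  rewrite /grad_hess F0 mul0mx mulmx0 mul0mx mxtrace0 mxE mul0r subr0 add0r.
  have -> : differential h y = 0.
    apply/rowP => k; rewrite !mxE; apply: is_pdP.
      exact: (rel_open_sub oU).
    by apply: (is_pd_eq oU Uy) (is_pd_cst k y a) => z /ha.
  rewrite mul0mx mxE sub0r /area Dw// addrC => /eqP.
  by rewrite subr_eq0 => /eqP.
have p0 : differential f x = 0.
  apply/rowP => k; rewrite !mxE.
  have d1 := is_pd_derive1n_comp sf sv (m := 1) (k := k) Ux.
  have d2 : is_pd k (fun y => derive1n 1 v (f y)) x 0.
    apply: (is_pd_eq oU Ux) (is_pd_cst k x (H * Num.sqrt (1 + w))) => y.
    by rewrite inE => Uy; rewrite -[RHS]/(derive1 v (f y)) v1.
  have Hx := rel_open_sub oU Ux.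
  have /eqP := etrans (esym (is_pdP Hx d1)) (is_pdP Hx d2).
  by rewrite v2// mulf_eq0 oppr_eq0 (negbTE c0) /= => /eqP.
by move/eqP: w0; apply; rewrite -(Dw x Ux) (inner_grad posG)// p0 mul0mx mxE.
Qed.

End Subharmonicity.

(** * Passage from charts to the manifold *)

Section Charts.
Variables (R : realType) (d : nat) (M : riemannian R d).
Implicit Types (k l : atlas M) (p : M).
Local Notation Hs := (halfspace R d).

Lemma rel_open_chart k : rel_open (chart_image k).
Proof. exact: chart_image_open. Qed.

Lemma chart_in_image k p : chart_dom k p -> chart_image k (chart k p).
Proof. by move=> kp; exists p. Qed.

Lemma chart_inv_dom k x : chart_image k x -> chart_dom k (chart_inv k x).
Proof. by move=> [p kp <-]; rewrite chartK. Qed.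

Lemma chart_invK k x : chart_image k x -> chart k (chart_inv k x) = x.
Proof. by move=> [p kp <-]; rewrite chartK. Qed.

Lemma near_transition k l p i : chart_dom k p -> chart_dom l p ->
  \forall s \near within (axis_line i (chart k p) @^-1` Hs) 0^',
    chart_dom l (chart_inv k (axis_line i (chart k p) s)).
Proof.
move=> kp lp; set x := chart k p.
have Ux : chart_image k x by exact: chart_in_image.
have nU := rel_open_near i (rel_open_chart k) Ux.
have /subspace_continuousP/(_ x Ux) cx := @chart_inv_continuous _ _ M k.
have nl : nbhs (chart_inv k x) (chart_dom l).
  by apply: open_nbhs_nbhs; split; [exact: chart_dom_open|rewrite chartK].
have {}cx : \forall y \near x, chart_image k y -> chart_dom l (chart_inv k y).
  exact: cx nl.
have ns : \forall s \near (0 : R), chart_image k (axis_line i x s) ->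
    chart_dom l (chart_inv k (axis_line i x s)).
  have c1 : nbhs (axis_line i x 0)
      [set y | chart_image k y -> chart_dom l (chart_inv k y)].
    by rewrite axis_line0.
  exact: (axis_line_continuous c1).
have nf : \forall s \near within (axis_line i x @^-1` Hs) 0^',
    chart_image k (axis_line i x s) ->
    chart_dom l (chart_inv k (axis_line i x s)).
  by rewrite near_withinE near_withinE; apply: filterS ns => s sP _ _.
by apply: filterS2 nU nf => s Us; apply.
Qed.

Variable phi : M -> R.
Hypothesis sphi : smooth phi.

(** Near the point [phi \o chart_inv k] factors through the chart [l]; the chain rule applies along
    each axis, one-sidedly at a boundary point. *)
Lemma differential_transition k l p : chart_dom k p -> chart_dom l p ->
  differential (phi \o chart_inv k) (chart k p) =
  differential (phi \o chart_inv l) (chart l p)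
    *m (transition_jacobian k l (chart k p))^T.
Proof.
move=> kp lp; set x := chart k p.
have Ux : chart_image k x by exact: chart_in_image.
have Hx := rel_open_sub (rel_open_chart k) Ux.
apply/rowP => i; rewrite mxE; apply: is_pdP => //.
pose c s := chart l (chart_inv k (axis_line i x s)).
have c0 : c 0 = chart l p by rewrite /c axis_line0 chartK.
have nl := near_transition i kp lp.
have chain := @chain_rule _ _ _ (rel_open_chart l) (phi \o chart_inv l)
  (axis_line i x @^-1` Hs) 0 c
  (fun a => transition_jacobian k l x i a) (sphi l 1%N).
rewrite [X in is_pd _ _ _ X](_ : _ =
  \sum_a pd a (phi \o chart_inv l) (c 0) * transition_jacobian k l x i a);
  last by rewrite c0 mxE; apply: eq_bigr => a _; rewrite !mxE.
apply: cvg_trans (chain _ _ _).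
- apply: quotient_in_near; first by rewrite /= c0 axis_line0 !chartK.
  by apply: filterS nl => s ls; rewrite /= /c chartK.
- by rewrite c0; exact: chart_in_image.
- apply: filterS nl => s ls; apply: (rel_open_sub (rel_open_chart l)).
  exact: chart_in_image.
- move=> a; rewrite mxE.
  have xkl : (chart_image k `&` (chart_inv k @^-1` chart_dom l)) x.
    by split=> //=; rewrite chartK.
  have [_ /(_ i)[/(_ x xkl) dx _]] := @transition_smooth _ _ M k l a 1%N.
  exact: dx.
Qed.

(** The squared length of the gradient is the inverse metric evaluated on the differential, and
    [gram_change] makes the Jacobians cancel. *)
Lemma area_transition k l p : chart_dom k p -> chart_dom l p ->
  area (gram k) (phi \o chart_inv k) (chart k p) =
  area (gram l) (phi \o chart_inv l) (chart l p).
Proof.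
move=> kp lp; rewrite /area.
have Uk := chart_in_image kp; have Ul := chart_in_image lp.
have uk := metric_unit (@gram_pos _ _ M k) Uk.
have ul := metric_unit (@gram_pos _ _ M l) Ul.
rewrite !gradE (inner_raise (@gram_sym _ _ M k) (@gram_pos _ _ M k))//.
rewrite (inner_raise (@gram_sym _ _ M l) (@gram_pos _ _ M l))//.
rewrite (differential_transition kp lp).
set J := transition_jacobian k l (chart k p).
have EG : gram k (chart k p) = J *m gram l (chart l p) *m J^T.
  exact: gram_change.
have uJ : J \in unitmx.
  by move: uk; rewrite EG -mulmxA unitmx_mul => /andP[].
have uJt : J^T \in unitmx by rewrite unitmx_tr.
have EV : J^T *m invmx (gram k (chart k p)) *m J = invmx (gram l (chart l p)).
  apply: (can_inj (mulKmx ul)); rewrite mulmxV//.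
  apply: (can_inj (mulKmx uJ)); rewrite mulmx1 !mulmxA -EG.
  by rewrite mulmxV// mul1mx.
by rewrite trmx_mul trmxK -!mulmxA (mulmxA J^T) (mulmxA _ J) EV.
Qed.

(** Parabolicity is tested on functions on [M], so a chart is chosen at each point; [graph_angleE]
    shows that the choice does not matter. *)
Definition graph_angle p : R :=
  angle (gram (chart_at p)) (phi \o chart_inv (chart_at p)) (chart (chart_at p) p).

Lemma graph_angleE k x : chart_image k x ->
  graph_angle (chart_inv k x) = angle (gram k) (phi \o chart_inv k) x.
Proof.
move=> Ux; have kp := chart_inv_dom Ux.
rewrite /graph_angle /angle; congr (- _^-1).
by rewrite (area_transition (chart_at_dom _) kp) chart_invK.
Qed.

(** The function is locally constant, so its level sets are open. Each is also closed, its
    complement being the union of the others. *)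
Lemma zero_differential_cst : connected [set: M] ->
  (forall k x i, chart_image k x -> pd i (phi \o chart_inv k) x = 0) ->
  forall p q, phi p = phi q.
Proof.
move=> cM d0 p q.
have loc (a : M) : nbhs a [set b | phi b = phi a].
  pose k := chart_at a; have ka : chart_dom k a by exact: chart_at_dom.
  have [r r0 rP] := locally_constant (rel_open_chart k) (sphi k 1%N)
    (chart_in_image ka) (fun i y Uy => d0 k y i Uy).
  have /subspace_continuousP/(_ a ka) ca := @chart_continuous _ _ M k.
  have nr : nbhs (chart k a)
      [set y | forall j, `|y 0 j - chart k a 0 j| < r].
    by apply/nbhs_boxP; exists r.
  have nk : nbhs a (chart_dom k).
    by apply: open_nbhs_nbhs; split=> //; exact: chart_dom_open.
  have nc : \forall b \near a, chart_dom k b ->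
      forall j, `|chart k b 0 j - chart k a 0 j| < r by exact: ca _ nr.
  apply: filterS2 nk nc => b kb' kb.
  have := rP (chart k b) _ (kb kb'); rewrite /= !chartK//; apply.
  exact: (rel_open_sub (rel_open_chart k) (chart_in_image kb')).
have oB c : open [set b | phi b = c].
  by rewrite openE => b /= bc; have := loc b; rewrite bc.
suff : [set b | phi b = phi q] = setT by move/seteqP=> [_ /(_ p)]; exact.
apply: cM; first by exists q.
- by exists [set b | phi b = phi q] => //; rewrite setTI.
- exists [set b | phi b = phi q]; rewrite ?setTI//.
  rewrite -[X in closed X]setCK closedC.
  have -> : ~` [set b | phi b = phi q] =
      \bigcup_(c in [set c | c <> phi q]) [set b | phi b = c].
    apply/seteqP; split=> b /=; first by move=> bq; exists (phi b).
    by move=> [c cq /= ->].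
  by apply: bigcup_open => c _; exact: oB.
Qed.

End Charts.

Unset Implicit Arguments.

Theorem corollary4p4 (R : realType) (d : nat) (M : riemannian R d)
  (o : atlas M -> M -> bool)
  (h : M -> R) (v : R -> R) (c : R) (phi : M -> R) :
  connected [set: M] ->
  is_orientation o ->
  complete_manifold M ->
  locally_convex_boundary M ->
  smooth h ->
  (forall (m : nat) (t : R), derivable (derive1n m v) t 1) ->
  (forall t : R, - (derive1n 2 v t) <= c) ->
  bakry_emery_ge h c ->
  smooth phi ->
  let psi := fun q : M * R => h q.1 + v q.2 in
  weighted_parabolic psi phi ->
  constant_weighted_mean_curvature psi phi ->
  free_boundary phi ->
  [\/ bakry_emery_gt h c,
      boundary M !=set0 /\ locally_strictly_convex_boundary M |
      (exists a : R, forall p, h p = a) /\ c != 0] ->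
  exists s : R, entire_graph phi = slice M s.
Proof.
move=> cM _ _ convM sh sv cv cG sphi psi parab [H cmc] free cases.
have oU := @rel_open_chart _ _ M.
have sG k : smooth_mx (chart_image k) (gram k) := @gram_smooth _ _ M k.
have symG := @gram_sym _ _ M; have posG := @gram_pos _ _ M.
pose f k := phi \o @chart_inv _ _ M k.
pose hk k := h \o @chart_inv _ _ M k.
have sf k : Cinfty (chart_image k) (f k) := sphi k.
have shk k : Cinfty (chart_image k) (hk k) := sh k.
have cH k x : chart_image k x ->
    mean_curvature_defect (gram k) (f k) (hk k) v H x = 0.
  move=> Ux; apply: (cmc_defect (oU k) (sG k) (symG k) (posG k) (sf k) (shk k) sv Ux).
  exact: cmc.
have freek k x (eta : 'rV[R]_(d.+1 + 1)) : chart_image k x -> x 0 ord0 = 0 ->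
    @inner_unit_normal R (d + 1) (cylinder_metric (gram k) (graph_map (f k) x)) eta ->
    inner (cylinder_metric (gram k) (graph_map (f k) x))
      (downward_normal (gram k) (f k) x) eta = 0.
  by move=> Ux x0 etaP; apply: (free k x eta) => //; split.
pose u := graph_angle phi.
have uE k : {in chart_image k, angle (gram k) (f k) =1 u \o chart_inv k}.
  by move=> x; rewrite inE => Ux; rewrite /= /u graph_angleE.
have sA k := smooth_angle (oU k) (sG k) (posG k) (sf k).
have gtE k : {in chart_image k, graph_metric (gram k) (f k) =1 graph_gram phi k}.
  move=> x; rewrite inE => Ux; apply/esym.
  exact: (@induced_metric_graph _ _ _ (gram k) (oU k) (f k) _ Ux).
have psiE k : psi \o cyl_param k \o graph_param phi k =
    fun y => hk k y + v (f k y).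
  apply/funext => y; rewrite /psi /cyl_param /= /graph_param.
  by rewrite /space_part /height row_mxKl row_mxKr mxE.
have LE k x : chart_image k x ->
    weighted_laplacian (graph_metric (gram k) (f k)) (fun y => hk k y + v (f k y))
      (angle (gram k) (f k)) x =
    weighted_laplacian (graph_gram phi k) (psi \o cyl_param k \o graph_param phi k)
      (u \o chart_inv k) x.
  move=> Ux; rewrite psiE; apply: (weighted_laplacian_eq (oU k)) => //.
  exact: graph_metric_smooth.
have conormal k x eta nu := @conormal_derivative_angle _ _ _ _ (oU k) (sG k)
  (symG k) (posG k) (f k) (sf k) (@freek k) x eta nu.
have pu k i x : chart_image k x ->
    pd i (angle (gram k) (f k)) x = pd i (u \o chart_inv k) x.
  move=> Ux; apply: (pd_in_eq (oU k) (uE k)); last by rewrite inE.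
  by move=> y Uy; apply: is_pd_has (Cinfty_is_pd (i := i) (sA k) Uy).
have [||||a ua] := parab u.
- by move=> k; exact: (Ck_eq (oU k) (uE k) (sA k 2%N)).
- by exists 0 => p; rewrite /u /graph_angle /angle oppr_le0 invr_ge0 sqrtr_ge0.
- move=> k x Ux _; rewrite -LE//.
  exact: (angle_subharmonic (oU k) (sG k) (symG k) (posG k) (sf k) (shk k) sv cv
           (cG k) (@cH k)).
- move=> k x nu [Ux x0]; rewrite -gtE ?inE// => nuP.
  have [eta etaP] := inner_unit_normal_exists (symG k x Ux) (posG k x Ux).
  under eq_bigr do rewrite -pu//.
  have [m m0 ->] := conormal k x eta nu Ux x0 etaP nuP.
  apply: mulr_ge0; first exact: ltW.
  apply: (convM k x eta) => //.
  exact: (free_grad (symG k) (posG k) (@freek k)).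
have angle_cst k x : chart_image k x -> angle (gram k) (f k) x = a.
  by move=> Ux; rewrite uE ?inE//= ua.
(* The constant [a] is [- 1 / W], so [a ^- 2] is [W ^+ 2 = 1 + |D|^2]. *)
have norm_cst k x : chart_image k x ->
    inner (gram k x) (grad (gram k) (f k) x) (grad (gram k) (f k) x) = a ^- 2 - 1.
  move=> Ux; rewrite -(angle_cst k x Ux) /angle sqrrN exprVn invrK expr2.
  rewrite (area_sqr (posG k))// (inner_grad (posG k))//.
  by rewrite addrC addKr.
have harm k x : chart_image k x ->
    weighted_laplacian (graph_metric (gram k) (f k)) (fun y => hk k y + v (f k y))
      (angle (gram k) (f k)) x = 0.
  move=> Ux; apply: (@weighted_laplacian_cst _ _ _ (oU k) _ _ _ a) => // y.
  by rewrite inE; exact: angle_cst.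
have D0 k x : chart_image k x -> grad (gram k) (f k) x = 0.
  move=> Ux; apply: (grad_eq0 (posG k) Ux).
  case: cases => [strict|[[p [l [lp bp]]] strict]|[[b hb] c0]].
  - have [e1 _ _] := angle_harmonic (oU k) (sG k) (symG k) (posG k) (sf k) (shk k)
      sv cv (cG k) (@cH k) Ux (harm k x Ux).
    have [->|D0] := eqVneq (grad (gram k) (f k) x) 0.
      by rewrite /inner !mul0mx mxE.
    by have := strict k x Ux _ D0; rewrite [X in _ < X]e1 ltxx.
  (* The length of the gradient is the same everywhere, so it suffices that it vanishes at one
     boundary point. There the conormal derivative of the constant angle is zero, hence so is the
     second fundamental form at the tangential vector [D]. *)
  - have Ul := chart_in_image lp.
    rewrite norm_cst// -(norm_cst l _ Ul).
    have [eta etaP] := inner_unit_normal_exists (symG l _ Ul) (posG l _ Ul).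
    have [nu nuP] := inner_unit_normal_exists
      (graph_metric_sym (symG l) (f l) Ul) (graph_metric_pos (posG l) (f l) Ul).
    have [m m0] := conormal l _ eta nu Ul bp etaP nuP.
    rewrite big1 => [/esym/eqP|i _]; last first.
      rewrite (_ : pd i _ _ = 0) ?mulr0//.
      apply: is_pdP; first exact: (rel_open_sub (oU l)).
      apply: (is_pd_eq (oU l) Ul) (is_pd_cst i _ a) => y; rewrite inE => Uy.
      by rewrite angle_cst.
    rewrite mulf_eq0 (gt_eqF m0) /= => /eqP second0.
    have [->|D0] := eqVneq (grad (gram l) (f l) (chart l p)) 0.
      by rewrite /inner !mul0mx mxE.
    have Dt := free_grad (symG l) (posG l) (@freek l) Ul bp.
    have := strict l _ eta _ (conj Ul bp) etaP Dt D0.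
    by rewrite second0 ltxx.
  - apply: (harmonic_cst_weight (oU k) (sG k) (symG k) (posG k) (sf k) (shk k)
      sv cv (cG k) (@cH k) (a := b)) => //.
      by move=> y _; exact: hb.
    exact: norm_cst.
    exact: harm.
have phi_cst : forall p q, phi p = phi q.
  apply: (zero_differential_cst sphi cM) => k x i Ux.
  have := grad_metric (posG k) (f k) Ux; rewrite D0// mul0mx.
  by move=> /rowP/(_ i); rewrite !mxE.
(* The empty space counts as connected; its graph and all its slices are empty. *)
have [[p0 _]|noM] := pselect ([set: M] !=set0).
  exists (phi p0); apply/seteqP; split=> [q [p _ <-]|[p t]].
    exact: phi_cst.
  rewrite /slice /= => ->.
  by exists p => //; rewrite (phi_cst p p0).
by exists 0; apply/seteqP; split=> [q [p _ _]|[p t] _]; case: noM; exists p.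
Qed.
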